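(* Let $k\ge1$, $n\ge2k+2$. The $(k+1)$-free subsets of $\binom{[n]}{2}$ are independent in the algebraic matroid of $\mathcal{P}f_k(n)$, and $k$-triangulations are bases of it.
   Context: Edges $\{i,j\},\{i',j'\}\in\binom{[n]}{2}$ with $i<j$, $i'<j'$ cross if $i<i'<j<j'$ or $i'<i<j'<j$. A $(k+1)$-crossing is a set of $k+1$ mutually crossing edges; a subset of $\binom{[n]}{2}$ is $(k+1)$-free if it contains no $(k+1)$-crossing; a $k$-triangulation is a maximal $(k+1)$-free subset. Let $\mathbb{K}$ be a field. For $U\subset[n]$ with $|U|=2k+2$, the Pfaffian of degree $k+1$ of $U$ is $\sum_E(-1)^{\mathrm{cr}(E)}\prod_{\{i,j\}\in E}x_{i,j}$ over perfect matchings $E$ of $U$, where $\mathrm{cr}(E)$ is the number of crossing pairs in $E$. $I_k(n)\subset\mathbb{K}[x_{i,j}:\{i,j\}\in\binom{[n]}{2}]$ is the (prime) ideal generated by all these Pfaffians, and $\mathcal{P}f_k(n)\subset\mathbb{K}^{\binom{[n]}{2}}$ is its variety: antisymmetric $n\times n$ matrices of rank at most $2k$. The algebraic matroid of $\mathcal{P}f_k(n)$ is the matroid of the prime ideal $I_k(n)$: its ground set is the set of variables $x_{i,j}$ (identified with $\binom{[n]}{2}$), and a subset $S$ is independent if $I_k(n)$ contains no nonzero polynomial involving only the variables in $S$. *)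

(* Defs.v *)
From mathcomp Require Import all_boot all_order all_algebra.
From mathcomp Require Import mpoly.

Set Implicit Arguments.
Unset Strict Implicit.
Unset Printing Implicit Defensive.

Import GRing.Theory.
Local Open Scope ring_scope.

(* A two-element subset {i, j} of [n] is encoded by its unique increasing
   listing (i, j), i < j; vertices are numbered from 0. *)
Definition edge (n : nat) := {e : 'I_n * 'I_n | (e.1 < e.2)%N}.

Definition edge_ends (n : nat) (e : edge n) : {set 'I_n} :=
  [set (val e).1; (val e).2].

Definition cross (n : nat) (e f : edge n) : bool :=
  let: (i, j) := val e in
  let: (i', j') := val f in
  [&& i < i', i' < j & j < j']%N || [&& i' < i, i < j' & j' < j]%N.

Definition is_crossing (n m : nat) (C : {set edge n}) : bool :=
  (#|C| == m) &&
  [forall e in C, forall f in C, (e != f) ==> cross e f].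

Definition crossing_free (n m : nat) (S : {set edge n}) : bool :=
  ~~ [exists C : {set edge n}, (C \subset S) && is_crossing m C].

Definition triangulation (n k : nat) (T : {set edge n}) : bool :=
  maxset (@crossing_free n k.+1) T.

Definition perfect_matching (n : nat) (U : {set 'I_n}) (E : {set edge n}) :
    bool :=
  partition [set edge_ends e | e in E] U.

(* A 2-crossing is an unordered pair of crossing edges. *)
Definition cr (n : nat) (E : {set edge n}) : nat :=
  #|[set C : {set edge n} | (C \subset E) && is_crossing 2 C]|.

(* Variables of {mpoly K[_]} are numbered by ordinals: x_e is the variable
   whose number is the rank of e among all edges. *)
Notation edge_poly K n := {mpoly K[#|{: edge n}|]}.

Definition pfaffian (K : fieldType) (n : nat) (U : {set 'I_n}) :
    edge_poly K n :=
  \sum_(E : {set edge n} | perfect_matching U E)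
     (-1) ^+ cr E * \prod_(e in E) 'X_(enum_rank e).

Definition pfaffian_ideal (K : fieldType) (n k : nat)
    (p : edge_poly K n) : Prop :=
  exists c : {set 'I_n} -> edge_poly K n,
    p = \sum_(U : {set 'I_n} | #|U| == (2 * k + 2)%N) c U * pfaffian K U.

Definition only_involves (K : fieldType) (n : nat) (S : {set edge n})
    (p : edge_poly K n) : Prop :=
  forall (m : 'X_{1.. #|{: edge n}|}) (e : edge n),
    m \in msupp p -> m (enum_rank e) != 0%N -> e \in S.

Definition matroid_independent (K : fieldType) (n k : nat) (S : {set edge n}) : Prop :=
  forall p : edge_poly K n,
    pfaffian_ideal k p -> only_involves S p -> p = 0.

Definition matroid_basis (K : fieldType) (n k : nat) (B : {set edge n}) : Prop :=
  matroid_independent K k B /\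
  forall S : {set edge n}, matroid_independent K k S -> B \subset S -> S = B.

(* Main.v *)
(* Independence. The matrices x_(i,l) = sum_(r < k) (A_r i B_r l - A_r l B_r i)
   satisfy the Pfaffians of degree k+1, and scaling A_r i by t^i and B_r l by
   t^-l singles out, as t -> 0, the ladder x_(i,l) = sum_(r < k) A_r i B_r l,
   i < l.  So it is enough to see that the coordinates in a (k+1)-free set S are
   algebraically independent on such ladders.  Reading the ladder (with its
   columns reversed) as the upper left part of a product M_Q(c) of matrices
   [[c_e, 1], [1, 0]], one for each letter e of the staircase word Q of the
   longest permutation, the ladder has this form when M_Q(c) = L w U with L lower
   and U upper triangular, where w is the identity on the first and the last k
   points and reverses the middle.  For a set D of letters with product w, the
   coordinates c_e with e not in D are independent on this locus, by induction on
   Q: for a letter in D the parameter is determined by L; for a letter not in D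
   one deforms the previous matrix to x_q(-t) M and takes c_e = 1/t.  Finally, the
   rank function of the Demazure product of the complement of S is the largest
   size of a crossing of S over each cut, so S is (k+1)-free iff this product is
   above w, and then the subword property gives D disjoint from S, reduced for w,
   whose complement is still (k+1)-free.

   Bases. The sets D above have as many elements as w has inversions, so every
   (k+1)-free set is contained in one of a fixed size d, and k-triangulations have
   size d.  The crossing monomial of each Pfaffian is its leading term for the
   weight (l - i)(n - (l - i)), so monomials with (k+1)-free support span modulo
   the ideal; counting monomials of bounded degree, an independent set has at most
   d elements. *)
Require Import Defs.
From mathcomp Require Import all_boot all_order all_algebra all_fingroup.
From mathcomp Require Import mpoly zify ring.

Set Implicit Arguments.
Unset Strict Implicit.
Unset Printing Implicit Defensive.

Import GRing.Theory.

(** * Polynomials and their initial forms *)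

Local Open Scope ring_scope.

Section InitialForms.

Variables (F : fieldType) (N : nat).
Implicit Types (p : {mpoly F[N]}) (w : 'I_N -> nat) (m : 'X_{1..N}).

Hypothesis F_inf : forall s : seq F, exists x, x \notin s.

Lemma poly_nonroot (q : {poly F}) : q != 0 -> exists2 t, t != 0 & q.[t] != 0.
Proof.
(* Multiplying by ['X] excludes the root 0 as well. *)
move=> q0; have q'0 : q * 'X != 0 by rewrite mulf_neq0 ?polyX_eq0.
have big_seq n : exists s : seq F, uniq s && (size s == n).
  elim: n => [|n [s /andP[us /eqP <-]]]; first by exists [::].
  by have [x xs] := F_inf s; exists (x :: s); rewrite /= xs us eqxx.
have [s /andP[us /eqP ss]] := big_seq (size (q * 'X)).
have /allPn[t _] : ~~ all (root (q * 'X)) s.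
  by apply/negP => /(max_poly_roots q'0)/(_ us); rewrite ss ltnn.
rewrite rootM rootX negb_or => /andP[qt t0].
by exists t.
Qed.

Definition mwt w m := (\sum_i m i * w i)%N.

(** The largest weight is meant: [initial_form] keeps the terms that dominate when the variable [i]
    grows like [t ^- w i] as [t] tends to 0. *)
Definition initial_deg w p := (\max_(m <- msupp p) mwt w m)%N.

Definition initial_form w p : {mpoly F[N]} :=
  \sum_(m <- msupp p | mwt w m == initial_deg w p) p@_m *: 'X_[m].

Lemma mcoeff_initial_form w p m :
  (initial_form w p)@_m = if mwt w m == initial_deg w p then p@_m else 0.
Proof.
rewrite /initial_form raddf_sum /=.
under eq_bigr => m' _ do rewrite mcoeffZ mcoeffX.
case: ifP => [mw|/negP mw]; last first.
  rewrite big1 // => m' /eqP m'w; case: eqP => [mm'|]; last by rewrite mulr0.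
  by case: mw; rewrite -mm' m'w.
have [ms|ms] := boolP (m \in msupp p).
  rewrite big_mkcond /= (bigD1_seq m) ?msupp_uniq //= mw eqxx mulr1 big1 ?addr0 //.
  by move=> m' m'm; rewrite (negbTE m'm) mulr0 if_same.
rewrite (eqP (_ : p@_m == 0)) ?mcoeff_eq0 // big_seq_cond big1 //.
move=> m' /andP[m's _]; case: eqP => [mm'|]; last by rewrite mulr0.
by rewrite -mm' m's in ms.
Qed.

Lemma msupp_initial_form w p m : m \in msupp (initial_form w p) ->
  m \in msupp p.
Proof.
by rewrite !mcoeff_msupp mcoeff_initial_form; case: ifP => //; rewrite eqxx.
Qed.

Lemma initial_deg_mem w p : p != 0 ->
  exists2 m, m \in msupp p & mwt w m = initial_deg w p.
Proof.
rewrite -msupp_eq0 /initial_deg.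
elim: (msupp p) => // m [|m' s] IH _.
  by exists m; rewrite ?mem_head // big_seq1.
have [m1 m1s e] := IH isT; rewrite big_cons -e.
case: (leqP (mwt w m) (mwt w m1)) => h.
  by exists m1; rewrite // in_cons m1s orbT.
by exists m; rewrite // mem_head.
Qed.

Lemma initial_form_neq0 w p : p != 0 -> initial_form w p != 0.
Proof.
move=> p0; have [m ms mw] := initial_deg_mem w p0.
rewrite mcoeff_msupp in ms; apply: contraNneq ms => e.
by rewrite -(mcoeff0 F m) -e mcoeff_initial_form mw eqxx.
Qed.

Lemma mwt_le w p m : m \in msupp p -> (mwt w m <= initial_deg w p)%N.
Proof. by move=> ms; rewrite /initial_deg (bigD1_seq m) ?msupp_uniq //= leq_maxl. Qed.

(** Multiplied by [t ^+ D], with [D] the initial degree, the value is a polynomial [G] in [t] whose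
    constant term is the value of the initial form at [x]; so [G] is nonzero and has a nonroot
    [t != 0]. *)
Lemma eval_near_initial_form w p (x : 'I_N -> F) (g : 'I_N -> {poly F}) :
    (forall i, (g i).[0] = x i) -> (initial_form w p).@[x] != 0 ->
  exists2 t, t != 0 & p.@[fun i => (g i).[t] / t ^+ w i] != 0.
Proof.
move=> gx px; pose D := initial_deg w p.
pose G := \sum_(m <- msupp p)
   (p@_m)%:P * 'X^(D - mwt w m) * \prod_i g i ^+ m i.
have G0 : G != 0.
  apply: contraNneq px => /(congr1 (horner_eval 0)).
  rewrite /horner_eval horner0 /G horner_sum => G0.
  rewrite /initial_form raddf_sum /= -[X in _ == X]G0 big_mkcond /=.
  rewrite [X in _ == X]big_seq big_seq; apply/eqP/eq_bigr => m ms.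
  rewrite !hornerM hornerC hornerXn horner_prod.
  have le_m := mwt_le w ms.
  case: eqP => [->|/eqP ne_m].
    rewrite subnn expr0 mulr1 mevalZ mevalX; congr (_ * _).
    by apply: eq_bigr => i _; rewrite horner_exp gx.
  by rewrite expr0n subn_eq0 leqNgt ltn_neqAle le_m ne_m mulr0 mul0r.
have [t t0 Gt] := poly_nonroot G0; exists t => //.
apply: contraNneq Gt; rewrite mevalE => pt.
rewrite -[X in _ == X](mulr0 (t ^+ D)) -pt mulr_sumr /G horner_sum.
apply/eqP; rewrite [LHS]big_seq [RHS]big_seq; apply: eq_bigr => m ms.
rewrite !hornerM hornerC hornerXn horner_prod mulrCA -mulrA; congr (_ * _).
have -> : t ^+ D = t ^+ (D - mwt w m) * t ^+ mwt w m.
  by rewrite -exprD subnK ?mwt_le.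
rewrite -mulrA; congr (_ * _).
rewrite /mwt -prodrXr.
rewrite -big_split /=; apply: eq_bigr => i _.
rewrite horner_exp expr_div_n -exprM mulnC mulrCA divff ?mulr1 //.
by rewrite expf_neq0.
Qed.

(** Induction on the number of terms. Two distinct monomials differ in the exponent of some
    variable; for the weight given by this exponent the initial form has fewer terms, and a point
    for it deforms into a point for [p]. *)
Lemma mpoly_nonvanishing p : p != 0 -> exists x : 'I_N -> F, p.@[x] != 0.
Proof.
have [n] := ubnP (size (msupp p)); elim: n p => // n IH p le_n p0.
have [/eqP s1|s_neq1] := boolP (size (msupp p) == 1).
  exists (fun=> 1); rewrite mevalE.
  case E: (msupp p) s1 => [|m [|]] // _; rewrite big_seq1 big1 => [|i _].
    by rewrite mulr1 -mcoeff_msupp E mem_head.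
  by rewrite expr1n.
have [m [m' [ms m's mm']]] :
    exists m m', [/\ m \in msupp p, m' \in msupp p & m != m'].
  move: s_neq1 p0 (msupp_uniq p); rewrite -msupp_eq0.
  case: (msupp p) => [|m [|m' s]] // _ _ /andP[mm _].
  exists m, m'; rewrite !in_cons !eqxx orbT; split=> //.
  by apply: contraNneq mm => ->; rewrite mem_head.
have [i ne_i] : exists i, m i != m' i.
  apply/existsP; apply: contraNT mm'; rewrite negb_exists => /forallP h.
  by apply/eqP/mnmP => i; apply/eqP; move: (h i); rewrite negbK.
pose w j : nat := j == i.
have wE m1 : mwt w m1 = m1 i.
  rewrite /mwt (bigD1 i) //= /w eqxx muln1 big1 ?addn0 // => j /negbTE ->.
  by rewrite muln0.
have [||x px] := IH (initial_form w p); last 1 first.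
- have [t _ pt] := eval_near_initial_form (fun j => hornerC (x j) 0) px.
  by eexists; exact: pt.
- apply: leq_trans (_ : size (msupp p) <= n)%N => //.
  have [m0 m0s m0n] : exists2 m0, m0 \in msupp p &
      m0 \notin msupp (initial_form w p).
    have [e|ne] := eqVneq (m i) (initial_deg w p).
      exists m' => //; rewrite mcoeff_msupp mcoeff_initial_form wE -e.
      by rewrite [m' i == _]eq_sym (negbTE ne_i) eqxx.
    exists m => //.
    by rewrite mcoeff_msupp mcoeff_initial_form wE (negbTE ne) eqxx.
  have /uniq_leq_size : uniq (m0 :: msupp (initial_form w p)).
    by rewrite /= m0n msupp_uniq.
  apply=> m1; rewrite in_cons => /orP[/eqP->//|]; exact: msupp_initial_form.
- exact: initial_form_neq0.
Qed.

End InitialForms.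

(** * Triangular matrices and letters *)

Local Open Scope ring_scope.

Section Triangular.

Variables (R : comNzRingType) (n : nat).
Implicit Types A B : 'M[R]_n.

Definition upper_unitri A :=
  forall i j : 'I_n, (j <= i)%N -> A i j = (i == j)%:R.

Lemma upper_unitri1 : upper_unitri 1%:M.
Proof. by move=> i j _; rewrite mxE. Qed.

Lemma upper_unitriM A B :
  upper_unitri A -> upper_unitri B -> upper_unitri (A *m B).
Proof.
move=> uA uB i j ji; rewrite mxE (bigD1 i) //= uA // eqxx mul1r uB //.
rewrite big1 ?addr0 // => l l_i; have [li|il] := leqP l i.
  by rewrite uA // eq_sym (negbTE l_i) mul0r.
rewrite uB ?(leq_trans ji) ?(ltnW il) // (_ : l == j = false) ?mulr0 //.
by apply/eqP => lj; move: il; rewrite lj ltnNge ji.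
Qed.

Definition elem_mx (q q' : 'I_n) (c : R) : 'M[R]_n :=
  1%:M + c *: delta_mx q q'.

Lemma mul_elem_mx q q' c A i j :
  (elem_mx q q' c *m A) i j = A i j + (i == q)%:R * c * A q' j.
Proof.
rewrite mulmxDl mul1mx -scalemxAl mxE; congr (_ + _).
rewrite mxE mxE (bigD1 q') //= mxE eqxx andbT big1 ?addr0 => [|l /negbTE l_q'].
  by rewrite mulrCA mulrA.
by rewrite mxE l_q' andbF mul0r.
Qed.

Lemma mul_mx_elem q q' c A i j :
  (A *m elem_mx q q' c) i j = A i j + (j == q')%:R * c * A i q.
Proof.
rewrite mulmxDr mulmx1 -scalemxAr mxE; congr (_ + _).
rewrite mxE mxE (bigD1 q) //= mxE eqxx /= big1 ?addr0 => [|l /negbTE l_q].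
  ring.
by rewrite mxE l_q mulr0.
Qed.

(** For [q != q'], the block [[c, 1], [1, 0]] in the rows and columns [q], [q']. *)
Definition letter_mx (q q' : 'I_n) (c : R) : 'M[R]_n :=
  elem_mx q q' c *m tperm_mx q q'.

Lemma mul_tperm_mx q q' A i j : (tperm_mx q q' *m A) i j = A (tperm q q' i) j.
Proof. by rewrite -row_permE mxE. Qed.

Lemma mul_mx_tperm q q' A i j : (A *m tperm_mx q q') i j = A i (tperm q q' j).
Proof. by rewrite /tperm_mx -{1}[tperm q q']tpermV -col_permE mxE. Qed.

Lemma mul_letter_mx q q' c A i j :
  (letter_mx q q' c *m A) i j =
    A (tperm q q' i) j + (i == q)%:R * c * A q j.
Proof. by rewrite -mulmxA mul_elem_mx !mul_tperm_mx tpermR. Qed.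

Lemma tperm_mxK q q' : tperm_mx q q' *m tperm_mx q q' = 1%:M :> 'M[R]_n.
Proof. by rewrite -perm_mxM tperm2 perm_mx1. Qed.

Lemma elem_mxK q q' c : q != q' -> elem_mx q q' c *m elem_mx q q' (- c) = 1%:M.
Proof.
move=> qq'; apply/matrixP => i j; rewrite mul_elem_mx !mxE.
rewrite [q' == q]eq_sym (negbTE qq') /= [q' == j]eq_sym -!mulnb !natrM; ring.
Qed.

Section Letter.

Variables (q q' : 'I_n).
Hypothesis qq' : q' = q.+1 :> nat.

Let neq_qq' : q != q'.
Proof. by rewrite -val_eqE /= qq' neq_ltn ltnSn. Qed.

(** With this [c'] the matrix [elem_mx q q' (- c') *m N *m elem_mx q q' c] has entry 0 at (q, q'),
    the only place above the diagonal that conjugation by the transposition moves below it. *)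
Lemma push_letter (N : 'M[R]_n) c : upper_unitri N ->
  let c' := c + N q q' in
  let N1 := tperm_mx q q' *m elem_mx q q' (- c') *m N
              *m elem_mx q q' c *m tperm_mx q q' in
  upper_unitri N1 /\ N *m letter_mx q q' c = letter_mx q q' c' *m N1.
Proof.
move=> uN c' N1; split; last first.
  rewrite /N1 /letter_mx !mulmxA -[_ *m tperm_mx q q' *m tperm_mx q q']mulmxA.
  by rewrite tperm_mxK mulmx1 elem_mxK // mul1mx.
have N1E i j : N1 i j =
    let i' := tperm q q' i in let j' := tperm q q' j in
    N i' j' + (j' == q')%:R * c * N i' q
    - (i' == q)%:R * c' * (N q' j' + (j' == q')%:R * c * N q' q).
  rewrite /N1 -!mulmxA mul_tperm_mx mul_elem_mx !mulmxA !mul_mx_tperm.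
  by rewrite !mul_mx_elem /= mulrN mulNr.
have Nq'q : N q' q = 0.
  by rewrite uN ?qq' // -val_eqE /= qq' eqn_leq ltnn.
have Nq'q' : N q' q' = 1 by rewrite uN ?eqxx.
have Nqq : N q q = 1 by rewrite uN ?eqxx.
move=> i j ji; rewrite N1E /= Nq'q mulr0 addr0.
have [iq'|iq'] := eqVneq i q'.
  rewrite iq' tpermR; have [jq|jq] := eqVneq j q.
    rewrite jq tpermL !eqxx Nqq Nq'q' [q' == q]eq_sym (negbTE neq_qq') /= /c'; ring.
  have [jq'|jq'] := eqVneq j q'.
    rewrite jq' tpermR !eqxx (negbTE neq_qq') Nqq Nq'q /=; ring.
  rewrite tpermD ?[q == j]eq_sym ?[q' == j]eq_sym // (negbTE jq').
  have jltq : (j < q)%N by move: ji jq jq'; rewrite iq' -!val_eqE /=; lia.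
  rewrite !uN ?(ltnW jltq) //; last by rewrite qq'; lia.
  rewrite [q' == j]eq_sym (negbTE jq') [q == j]eq_sym (negbTE jq) /=; ring.
have [iq|iq] := eqVneq i q.
  rewrite iq tpermL; have [jq|jq] := eqVneq j q.
    rewrite jq tpermL !eqxx Nq'q Nq'q' [q' == q]eq_sym (negbTE neq_qq') /=; ring.
  have jltq : (j < q)%N by move: ji jq; rewrite iq -!val_eqE /=; lia.
  have jq' : j != q' by rewrite -val_eqE /= qq'; lia.
  rewrite tpermD ?[q == j]eq_sym ?[q' == j]eq_sym // (negbTE jq').
  rewrite [q' == q]eq_sym (negbTE neq_qq') uN; last by rewrite qq'; lia.
  by rewrite [q' == j]eq_sym (negbTE jq') /=; ring.
rewrite [tperm q q' i]tpermD ?[q == i]eq_sym ?[q' == i]eq_sym //.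
rewrite (negbTE iq) !mul0r subr0.
have [jq|jq] := eqVneq j q.
  have qlti : (q' < i)%N.
    by move: ji iq' iq; rewrite jq -!val_eqE /= qq'; lia.
  rewrite jq tpermL eqxx !uN ?(ltnW qlti) //; last by lia.
  by rewrite (negbTE iq') (negbTE iq) mulr0 addr0.
have [jq'|jq'] := eqVneq j q'.
  have qlti : (q' < i)%N by move: ji iq'; rewrite jq' -!val_eqE /=; lia.
  rewrite jq' tpermR (negbTE neq_qq') !mul0r addr0 uN; last by lia.
  by rewrite (negbTE iq') (negbTE iq).
rewrite tpermD ?[q == j]eq_sym ?[q' == j]eq_sym //.
by rewrite (negbTE jq') !mul0r addr0 uN.
Qed.

End Letter.

End Triangular.

Lemma upper_unitri_inv (F : fieldType) n (U : 'M[F]_n) : upper_unitri U ->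
  exists2 V : 'M[F]_n, U *m V = 1%:M & forall i j : 'I_n, (j < i)%N -> V i j = 0.
Proof.
move=> uU; have unitU : U \in unitmx.
  rewrite unitmxE -det_tr det_trig.
    rewrite big1 ?unitr1 // => i _; by rewrite mxE uU ?eqxx.
  apply/is_trig_mxP => i j ij; rewrite mxE uU 1?ltnW // -val_eqE /=.
  by rewrite gtn_eqF.
exists (invmx U); first exact: mulmxV.
move=> i j; have [d] := ubnP (n - i); elim: d i => // d IH i le_d ji.
have := congr1 (fun A : 'M_n => A i j) (mulmxV unitU).
rewrite mxE [RHS]mxE -val_eqE /= (gtn_eqF ji) (bigD1 i) //= uU // eqxx mul1r.
rewrite big1 ?addr0 // => l l_i; have [li|il] := leqP l i.
  by rewrite uU // eq_sym (negbTE l_i) mul0r.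
by rewrite IH ?mulr0 //; have := ltn_ord l; lia.
Qed.

(** * Lower triangular factors *)

Section Lower.

Variables (F : fieldType) (n : nat).
Implicit Types L A : 'M[F]_n.

Definition lower_unit L :=
  (forall i j : 'I_n, (i < j)%N -> L i j = 0) /\ (forall i, L i i != 0).

Lemma lower_unit1 : lower_unit 1%:M.
Proof.
split=> [i j ij|i]; rewrite mxE ?eqxx ?oner_eq0 //.
by rewrite -val_eqE /= ltn_eqF.
Qed.

Lemma lower_unitM L1 L2 : lower_unit L1 -> lower_unit L2 ->
  lower_unit (L1 *m L2).
Proof.
move=> [l1 d1] [l2 d2]; split=> [i j ij|i]; rewrite mxE.
  apply: big1 => l _; have [li|il] := leqP l i; last by rewrite l1 ?mul0r.
  by rewrite l2 ?mulr0 // (leq_ltn_trans li).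
rewrite (bigD1 i) //= big1 ?addr0 ?mulf_neq0 // => l.
rewrite neq_ltn => /orP[h|h]; first by rewrite l2 ?mulr0.
by rewrite l1 ?mul0r.
Qed.

Variables (q q' : 'I_n).
Hypothesis qq' : q' = q.+1 :> nat.

Let neq_qq' : q != q'.
Proof. by rewrite -val_eqE /= qq' neq_ltn ltnSn. Qed.

(** Swapping columns in [letter_mx q q' c *m L] can spoil triangularity only at (q, q'), where the
    entry is [L q' q + c * L q q]; its vanishing determines [c]. *)
Lemma lower_unit_swap L : lower_unit L ->
  exists c L', lower_unit L' /\ letter_mx q q' c *m L = L' *m tperm_mx q q'.
Proof.
move=> [lL dL]; exists (- L q' q / L q q).
set c := - _ / _.
have cE : L q' q + c * L q q = 0 by rewrite /c divfK // addrN.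
exists (letter_mx q q' c *m L *m tperm_mx q q'); split; last first.
  by rewrite -[RHS]mulmxA tperm_mxK mulmx1.
clearbody c; split=> [i j ij|i]; rewrite mul_mx_tperm mul_letter_mx.
  have [iq|iq] := eqVneq i q.
    rewrite iq tpermL mul1r; have [jq'|jq'] := eqVneq j q'.
      by rewrite jq' tpermR.
    have ltj : (q' < j)%N by move: ij jq'; rewrite iq -!val_eqE /= qq'; lia.
    rewrite tpermD; try by rewrite -val_eqE /=; lia.
    by rewrite !lL ?mulr0 ?addr0 // -qq'; lia.
  rewrite !mul0r addr0; have [iq'|iq'] := eqVneq i q'.
    move: ij; rewrite iq' => ij; rewrite tpermR tpermD ?lL //;
      try by rewrite -val_eqE /=; lia.
    lia.
  rewrite [tperm q q' i]tpermD ?[q == i]eq_sym ?[q' == i]eq_sym //.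
  apply: lL.
  by case: tpermP ij => [->|->|_ _ //]; move: iq iq'; rewrite -!val_eqE /=; lia.
have [->|iq] := eqVneq i q.
  by rewrite tpermL [L q q']lL ?qq' // mulr0 addr0.
by rewrite !mul0r addr0.
Qed.

(** The 2 by 2 identity [[1/t, 1], [1, 0]] [[1, -t], [0, 1]] = [[1/t, 0], [1, -t]]. *)
Lemma lower_unit_letter t : t != 0 ->
  lower_unit (letter_mx q q' t^-1 *m elem_mx q q' (- t)).
Proof.
move=> t0; set G := _ *m _.
have GE i j : G i j = (tperm q q' i == j)%:R
    - t * ((tperm q q' i == q) && (j == q'))%:R
    + (i == q)%:R * t^-1 * ((q == j)%:R - t * (j == q')%:R).
  by rewrite /G mul_letter_mx !mxE eqxx !mulNr.
have Gq j : G q j = (q == j)%:R * t^-1.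
  rewrite GE tpermL eqxx [q' == q]eq_sym (negbTE neq_qq') [q' == j]eq_sym /=.
  by field.
have Gq' j : G q' j = (q == j)%:R - t * (j == q')%:R.
  by rewrite GE tpermR eqxx [q' == q]eq_sym (negbTE neq_qq') /= !mul0r addr0.
have Gi i j : i != q -> i != q' -> G i j = (i == j)%:R.
  move=> iq iq'; rewrite GE tpermD ?[q == i]eq_sym ?[q' == i]eq_sym //.
  by rewrite (negbTE iq) /= !mul0r mulr0 subr0 addr0.
split=> [i j ij|i].
  have ne_ij : i == j = false by rewrite -val_eqE /= ltn_eqF.
  have [iq|iq] := eqVneq i q; first by rewrite iq Gq -iq ne_ij mul0r.
  have [iq'|iq'] := eqVneq i q'; last by rewrite Gi ?ne_ij.
  rewrite iq' Gq' eq_sym -iq' [j == i]eq_sym ne_ij mulr0 subr0.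
  by rewrite -val_eqE /= gtn_eqF // (leq_trans _ (ltnW ij)) // iq' qq'.
have [->|iq] := eqVneq i q; first by rewrite Gq eqxx mul1r invr_eq0.
have [->|iq'] := eqVneq i q'; last by rewrite Gi ?eqxx ?oner_eq0.
by rewrite Gq' eqxx (negbTE neq_qq') sub0r mulr1 oppr_eq0.
Qed.

End Lower.

(** * Bruhat cells of a word *)

Local Open Scope ring_scope.

Section Words.

Variables (T : finType) (n : nat) (lo hi : T -> 'I_n).
Hypothesis lo_hi : forall e, hi e = (lo e).+1 :> nat.

Definition word_mx (R : comNzRingType) (c : T -> R) (Q : seq T) : 'M[R]_n :=
  foldr (fun e A => letter_mx (lo e) (hi e) (c e) *m A) 1%:M Q.

Definition word_perm (D : pred T) (Q : seq T) : 'S_n :=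
  foldr (fun e s => if D e then (tperm (lo e) (hi e) * s)%g else s) 1%g Q.

Lemma eq_word_mx (R : comNzRingType) (c c' : T -> R) Q :
  {in Q, c =1 c'} -> word_mx c Q = word_mx c' Q.
Proof.
elim: Q => //= e Q IH cc'; rewrite cc' ?mem_head // IH // => e' e'Q.
by rewrite cc' // in_cons e'Q orbT.
Qed.

Lemma map_word_mx (R R' : comNzRingType) (f : {rmorphism R -> R'}) c Q :
  map_mx f (word_mx c Q) = word_mx (f \o c) Q.
Proof.
elim: Q => [|e Q IH] /=; first by rewrite map_mx1.
rewrite map_mxM IH /letter_mx map_mxM map_tperm_mx /elem_mx map_mxD map_mx1.
by rewrite map_mxZ map_delta_mx.
Qed.

Variable F : fieldType.

(** Iteration of [push_letter]. As [N] is the identity at 0, each parameter changes by a polynomial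
    without constant term, and the matrix passed on is again the identity at 0. *)
Lemma push_word Q (c : T -> F) (N : 'M[{poly F}]_n) : uniq Q ->
    upper_unitri N -> (forall i j, (N i j).[0] = (i == j)%:R) ->
  exists (g : T -> {poly F}) (N' : 'M[{poly F}]_n),
   [/\ forall e, (g e).[0] = c e,
       forall e, e \notin Q -> g e = (c e)%:P,
       upper_unitri N'
     & N *m word_mx (fun e => (c e)%:P) Q = word_mx g Q *m N'].
Proof.
elim: Q N => [|e Q IH] N /=.
  move=> _ uN _; exists (fun e => (c e)%:P), N; split=> // [e|].
    by rewrite hornerC.
  by rewrite mulmx1 mul1mx.
move=> /andP[eQ uQ] uN N0.
have [uN1 NN1] := push_letter (lo_hi e) (c e)%:P uN.
move: uN1 NN1; set c' := _ + _; set N1 := _ *m tperm_mx _ _ => uN1 NN1.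
have lh : (hi e == lo e) = false.
  by rewrite -val_eqE /= lo_hi gtn_eqF.
have c'0 : c'.[0] = c e.
  by rewrite hornerD hornerC N0 eq_sym lh addr0.
clearbody c'.
have N10 i j : (N1 i j).[0] = (i == j)%:R.
  rewrite /N1 -!mulmxA mul_tperm_mx mul_elem_mx !mulmxA !mul_mx_tperm.
  rewrite !mul_mx_elem !(hornerD, hornerM, hornerN) !hornerMn !hornerC c'0 !N0 lh.
  rewrite (inj_eq (@perm_inj _ (tperm _ _))).
  by rewrite [hi e == _]eq_sym /=; ring.
have [g [N' [g0 gQ uN' E]]] := IH N1 uQ uN1 N10.
exists (fun e' => if e' == e then c' else g e'), N'; split => //.
- by move=> e'; case: eqP => [->|].
- by move=> e'; rewrite in_cons negb_or => /andP[/negbTE-> /gQ].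
rewrite mulmxA NN1 -[LHS]mulmxA E mulmxA eqxx; congr (_ *m _ *m _).
apply: eq_word_mx => e' e'Q; case: eqP => // ee'.
by rewrite -ee' e'Q in eQ.
Qed.

(** [U] is kept on the left to avoid its inverse: the product of the letters lies in the double
    coset of [s] for lower and unipotent upper triangular matrices. *)
Definition in_cell (x : T -> F) (Q : seq T) (s : 'S_n) :=
  exists L U : 'M[F]_n, [/\ lower_unit L, upper_unitri U
    & word_mx x Q *m U = L *m perm_mx s].

Hypothesis F_inf : forall s : seq F, exists x, x \notin s.

(** This expresses that the coordinates of the letters outside [D] are algebraically independent on
    the cell. *)
Lemma in_cell_dense (D : pred T) Q (p : {mpoly F[#|T|]}) : uniq Q -> p != 0 ->
    (forall m e, m \in msupp p -> e \in Q -> D e -> m (enum_rank e) = 0%N) ->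
  exists2 x : T -> F, in_cell x Q (word_perm D Q)
    & p.@[x \o enum_val] != 0.
Proof.
elim: Q p => [|e Q IH] p /=.
  move=> _ p0 _; have [x px] := mpoly_nonvanishing F_inf p0.
  exists (x \o enum_rank).
    exists 1%:M, 1%:M; split; [exact: lower_unit1|exact: upper_unitri1|].
    by rewrite perm_mx1.
  by rewrite (meval_eq (v2 := x)) // => i /=; rewrite enum_valK.
move=> /andP[eQ uQ] p0 pD.
have pDQ m e' : m \in msupp p -> e' \in Q -> D e' -> m (enum_rank e') = 0%N.
  by move=> mp e'Q De'; apply: pD => //; rewrite in_cons e'Q orbT.
case: (boolP (D e)) => De.
  (* For a letter in [D] the parameter is dictated by [L]; the value of [p] is kept because [p] does
     not involve it. *)
  have [x [L [U [lL uU E]]] px] := IH p uQ p0 pDQ.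
  have [c [L' [lL' E']]] := lower_unit_swap (lo_hi e) lL.
  pose x' e' := if e' == e then c else x e'.
  exists x'.
    exists L', U; split => //.
    rewrite [word_mx _ _]/= {1}/x' eqxx perm_mxM mulmxA -E'.
    rewrite -[LHS]mulmxA -[RHS]mulmxA -E.
    congr (_ *m (_ *m _)); apply: eq_word_mx => e' e'Q.
    by rewrite /x'; case: eqP => // ee'; rewrite -ee' e'Q in eQ.
  rewrite (_ : p.@[_] = p.@[x \o enum_val]) // !mevalE.
  rewrite [LHS]big_seq [RHS]big_seq; apply: eq_bigr => m mp; congr (_ * _).
  apply: eq_bigr => i _ /=; rewrite /x'; case: eqP => // ie.
  have -> : m i = 0%N by rewrite -(enum_valK i) ie pD // mem_head.
  by rewrite !expr0.
(* The weight is the degree in the variable of [e], whose parameter will tend to infinity. *)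
pose w (i : 'I_#|T|) : nat := i == enum_rank e.
(* The extra factor forces [x e != 0], so that [x e] can be inverted. *)
pose P := initial_form w p * 'X_(enum_rank e).
have P0 : P != 0.
  by rewrite mulf_neq0 ?initial_form_neq0 // -msize_poly_eq0 msizeX.
have PD m e' : m \in msupp P -> e' \in Q -> D e' -> m (enum_rank e') = 0%N.
  move=> mP e'Q De';
  have := perm_mem (msuppMX (initial_form w p) U_(enum_rank e)) m.
  rewrite mP => /esym/mapP[m' m'p ->].
  rewrite mnmDE (pDQ _ e' (msupp_initial_form m'p)) // mnm1E.
  by case: eqP => // /enum_rank_inj ee'; move: De; rewrite ee' De'.
have [x [L [U [lL uU E]]]] := IH P uQ P0 PD.
rewrite mevalM mevalXU mulf_eq0 negb_or /= enum_rankK => /andP[px xe].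
(* At [t] this is [elem_mx] with entry [- (t / x e)], which matches the parameter [x e / t] of [e]
   in [lower_unit_letter]. *)
pose N : 'M[{poly F}]_n := elem_mx (lo e) (hi e) (- (x e)^-1 *: 'X).
have NE i j : N i j =
    (i == j)%:R + (- (x e)^-1 *: 'X) * ((i == lo e) && (j == hi e))%:R.
  by rewrite /N !mxE.
have lo_lt_hi : (lo e < hi e)%N by rewrite lo_hi.
have uN : upper_unitri N.
  move=> i j ji; rewrite NE; case: andP => [[/eqP i_lo /eqP j_hi]|_].
    by move: ji; rewrite i_lo j_hi leqNgt lo_lt_hi.
  by rewrite mulr0 addr0.
have N0 i j : (N i j).[0] = (i == j)%:R.
  rewrite NE hornerD hornerM hornerZ hornerX mulr0 mul0r addr0.
  by rewrite hornerMn hornerC.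
have [g [N' [g0 gQ uN' EN]]] := push_word x uQ uN N0.
have [t t0 pt] := eval_near_initial_form F_inf (fun i => g0 (enum_val i)) px.
exists (fun e' => (g e').[t] / t ^+ w (enum_rank e')); last first.
  by rewrite (meval_eq (v2 := fun i => (g (enum_val i)).[t] / t ^+ w i)) // => i;
    rewrite /= enum_valK.
pose Nt := map_mx (horner_eval t) N; pose N't := map_mx (horner_eval t) N'.
have uN't : upper_unitri N't.
  move=> i j ji; rewrite /N't mxE uN' // /horner_eval.
  by rewrite hornerMn hornerC.
have ENt : Nt *m word_mx x Q = word_mx (fun e' => (g e').[t]) Q *m N't.
  have := congr1 (map_mx (horner_eval t)) EN.
  rewrite !map_mxM !map_word_mx /= => H.
  rewrite -[RHS]H; congr (_ *m _); apply: eq_word_mx => e' _ /=.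
  by rewrite /horner_eval hornerC.
have NtE : Nt = elem_mx (lo e) (hi e) (- (t / x e)).
  apply/matrixP => i j; rewrite mxE NE /horner_eval !mxE hornerD hornerM hornerZ.
  by rewrite hornerX !hornerMn !hornerC mulNr [(x e)^-1 * t]mulrC.
have tx0 : t / x e != 0 by rewrite mulf_neq0 // invr_eq0.
have := lower_unit_letter (lo_hi e) tx0.
rewrite -NtE => lG.
exists (letter_mx (lo e) (hi e) (t / x e)^-1 *m Nt *m L), (N't *m U); split.
- exact: lower_unitM.
- exact: upper_unitriM.
rewrite [word_mx _ (e :: Q)]/= gQ // hornerC {1}/w eqxx expr1 invf_div.
rewrite -[LHS]mulmxA -[RHS]mulmxA -E -[RHS]mulmxA; congr (_ *m _).
rewrite !mulmxA ENt; congr (_ *m _ *m _).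
apply: eq_word_mx => e' e'Q; rewrite /w; case: eqP => [/enum_rank_inj ee'|_].
  by rewrite -ee' e'Q in eQ.
by rewrite expr0 divr1.
Qed.

End Words.

(** * Demazure products *)

Local Open Scope nat_scope.

Section RankFunction.

Variable n : nat.
Implicit Types s w u : 'S_n.

(* [rk s <= rk w] pointwise means that [s] is above [w] in the Bruhat order. *)
Definition rk s (x b : nat) := \sum_(i < n) ((i < x) && (s i < b)).

Lemma rk0 s b : rk s 0 b = 0.
Proof. by rewrite /rk big1. Qed.

Lemma rkS s (i : 'I_n) b : rk s i.+1 b = rk s i b + (s i < b).
Proof.
rewrite /rk (bigD1 i) //= [in RHS](bigD1 i) //= ltnn ltnSn add0n addnC.
congr (_ + _); apply: eq_bigr => j ji; congr (nat_of_bool (_ && _)).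
by move: ji; rewrite -val_eqE /=; lia.
Qed.

Lemma rk_le_add s x d b : x + d <= n -> rk s (x + d) b <= rk s x b + d.
Proof.
elim: d => [|d IH] xd; first by rewrite !addn0.
have xd_n : x + d < n by lia.
rewrite addnS (rkS s (Ordinal xd_n)) /=.
by have := IH (ltnW xd_n); case: (_ < b); lia.
Qed.

Lemma rk_mono s x y b : x <= y -> rk s x b <= rk s y b.
Proof.
move=> xy; apply: leq_sum => i _; case: (ltnP i x) => //= ix.
by rewrite (leq_trans ix xy).
Qed.

Lemma rk_mono_r s x b c : b <= c -> rk s x b <= rk s x c.
Proof.
move=> xy; apply: leq_sum => i _; case: (i < x) => //=.
by case: (ltnP (s i) b) => // ib; rewrite (leq_trans ib xy).
Qed.

Lemma sum_lt_ord x : \sum_(i < n) (i < x) = minn x n.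
Proof.
have [xn|nx] := leqP x n.
  rewrite -[RHS]muln1 -[X in X * 1]card_ord -sum_nat_const.
  rewrite (big_ord_widen n (fun=> 1) xn) [RHS]big_mkcond /=.
  by apply: eq_bigr => i _; case: (_ < _).
rewrite -[RHS]muln1 -[X in X * 1]card_ord -sum_nat_const; apply: eq_bigr => i _.
by rewrite (ltn_trans (ltn_ord i)).
Qed.

Lemma rk_le_row s x b : rk s x b <= x.
Proof.
apply: leq_trans (geq_minl x n); rewrite -sum_lt_ord.
by apply: leq_sum => i _; case: (i < x) => //; case: (s i < b).
Qed.

Lemma rk_le_col s x b : rk s x b <= b.
Proof.
apply: leq_trans (geq_minl b n); rewrite -sum_lt_ord.
rewrite [X in _ <= X](reindex_inj (@perm_inj _ s)) /=.
by apply: leq_sum => i _; case: (i < x) => //; case: (s i < b).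
Qed.

Lemma rk1 x b : x <= n -> rk 1%g x b = minn x b.
Proof.
move=> xn; elim: x xn => [|x IH] xn; first by rewrite rk0 min0n.
by rewrite (rkS _ (Ordinal xn)) perm1 IH ?(ltnW xn) //=; lia.
Qed.

Lemma rk_inj s w : (forall x b, rk s x b = rk w x b) -> s = w.
Proof.
move=> sw; apply/permP => i; apply/val_inj/eqP => /=; rewrite eqn_leq.
have H j : (s i < j) = (w i < j).
  by have := rkS s i j; rewrite !sw rkS => /addnI; do 2!case: (_ < j).
by have := H (s i).+1; have := H (w i).+1; rewrite !ltnSn !ltnS => -> <-.
Qed.

Lemma rk1_min w : (forall x b, rk 1%g x b <= rk w x b) -> w = 1%g.
Proof.
move=> w1; apply: rk_inj => x b; apply/eqP; rewrite eqn_leq w1 andbT.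
have [xn|nx] := leqP x n; first by rewrite rk1 // leq_min rk_le_row rk_le_col.
have E s : rk s x b = rk s n b.
  by apply: eq_bigr => i _; rewrite (ltn_trans (ltn_ord i) nx) ltn_ord.
by rewrite !E rk1 // leq_min rk_le_row rk_le_col.
Qed.

Section Swap.

Variables (q q' : 'I_n).
Hypothesis qq' : q' = q.+1 :> nat.

Lemma rk_swap s x b : x != q' :> nat -> rk (tperm q q' * s)%g x b = rk s x b.
Proof.
move=> xq'; rewrite /rk [RHS](reindex_inj (@perm_inj _ (tperm q q'))) /=.
apply: eq_bigr => i _; rewrite permM; congr (nat_of_bool (_ && _)).
by case: tpermP => [->|->|_ _] //; move: xq'; lia.
Qed.

Lemma rk_swap_hi s b : rk (tperm q q' * s)%g q' b = rk s q b + (s q' < b).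
Proof. by rewrite {1}qq' rkS permM tpermL rk_swap // qq' neq_ltn ltnSn. Qed.

(** The lifting property of the Bruhat order. In each column, the row [q'] of [w] is either one more
    than the row [q] or, by the ascent, equal to the row [q'.+1]; the rows of [s] grow by 0 or 1. *)
Lemma rk_lift w s : w q < w q' ->
    (forall x b, x != q' :> nat -> rk s x b <= rk w x b) ->
  forall x b, rk s x b <= rk w x b.
Proof.
move=> w_asc sw x b; have [->|] := eqVneq x (q' : nat); last exact: sw.
have q_q' : (q : nat) != q' by rewrite qq' neq_ltn ltnSn.
have q'_q' : q'.+1 != q' by rewrite neq_ltn ltnSn orbT.
have := sw q b q_q'; have := sw q'.+1 b q'_q'.
rewrite !rkS qq' !rkS; move: w_asc; lia.
Qed.

Definition inversions s :=
  [set p : 'I_n * 'I_n | (p.1 < p.2) && (s p.2 < s p.1)].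

(** Swapping the two positions carries inversions of [s] to inversions and adds only the pair (q,
    q'). *)
Lemma card_inversions_swap s : s q < s q' ->
  #|inversions (tperm q q' * s)| = #|inversions s|.+1.
Proof.
move=> s_asc; pose t p := (tperm q q' p.1, tperm q q' p.2).
have tK : involutive t by move=> [i j]; rewrite /t /= !tpermK.
have -> : inversions (tperm q q' * s) = (q, q') |: (t @: inversions s).
  apply/setP => -[i j]; rewrite !inE /= -{2}[(i, j)]tK.
  rewrite (mem_imset _ _ (inv_inj tK)) !inE /= !permM xpair_eqE.
  case: (tpermP q q' i) => [->|->|/eqP iq /eqP iq'];
    case: (tpermP q q' j) => [->|->|/eqP jq /eqP jq'];
    rewrite ?eqxx ?(negbTE iq) ?(negbTE iq') ?(negbTE jq) ?(negbTE jq') //=;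
    rewrite -?val_eqE /=; move: s_asc; rewrite ?qq';
    try (move: iq iq'; rewrite -!val_eqE /=);
    try (move: jq jq'; rewrite -!val_eqE /=); rewrite ?qq'; lia.
rewrite cardsU1 (card_imset _ (inv_inj tK)) -{1}[(q, q')]tK.
by rewrite (mem_imset _ _ (inv_inj tK)) inE /= tpermL tpermR qq' ltnNge leqnSn.
Qed.

End Swap.

End RankFunction.

Lemma inversions1 n : inversions (1%g : 'S_n) = set0.
Proof.
apply/setP => p; rewrite !inE !perm1; case: ltngtP => //.
Qed.

Section Demazure.

Variables (T : finType) (n : nat) (lo hi : T -> 'I_n).
Hypothesis lo_hi : forall e, hi e = (lo e).+1 :> nat.

(** The Demazure product of the letters outside [S]: a letter acts only if it adds an inversion. *)
Definition demazure (S : {set T}) (Q : seq T) : 'S_n :=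
  foldr (fun e (s : 'S_n) => if (e \notin S) && (s (lo e) < s (hi e))
                    then (tperm (lo e) (hi e) * s)%g else s) 1%g Q.

Lemma eq_demazure (S S' : {set T}) Q :
  {in Q, S =i S'} -> demazure S Q = demazure S' Q.
Proof.
elim: Q => //= e Q IH SS'; rewrite IH ?SS' ?mem_head // => e' e'Q.
by rewrite SS' // in_cons e'Q orbT.
Qed.

Lemma eq_word_perm (D D' : pred T) Q :
  {in Q, D =1 D'} -> word_perm lo hi D Q = word_perm lo hi D' Q.
Proof.
elim: Q => //= e Q IH DD'; rewrite IH ?DD' ?mem_head // => e' e'Q.
by rewrite DD' // in_cons e'Q orbT.
Qed.

(** The subword property, greedily from the head: a letter enters [D] exactly if it lies outside [S]
    and is a descent of the permutation still to be written. For letters outside [S] the lifting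
    property carries the rank inequality over to the tail. *)
Lemma demazure_subword (S : {set T}) Q (w : 'S_n) : uniq Q ->
    (forall x b, rk (demazure S Q) x b <= rk w x b) ->
  exists D : {set T}, [/\ D \subset [set e in Q], [disjoint D & S],
    word_perm lo hi (mem D) Q = w, demazure (~: D) Q = w
    & #|D| = #|inversions w|].
Proof.
elim: Q w => [|e Q IH] w /=.
  move=> _ /rk1_min->; exists set0; rewrite inversions1 sub0set !cards0.
  by split=> //; rewrite disjoint_subset; apply/subsetP => x; rewrite inE.
move=> /andP[eQ uQ]; set u := demazure S Q => uw.
have skip : (forall x b, rk u x b <= rk w x b) ->
    exists D : {set T}, [/\ D \subset [set e' in e :: Q], [disjoint D & S],
      word_perm lo hi (mem D) (e :: Q) = w, demazure (~: D) (e :: Q) = w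
      & #|D| = #|inversions w|].
  move=> /(IH _ uQ)[D [DQ DS wD dD cD]]; exists D.
  have eD : e \notin D by apply: contra eQ => /(subsetP DQ); rewrite inE.
  split=> //=; first by apply/subsetP => e' /(subsetP DQ);
    rewrite !inE orbC => ->.
    by rewrite (negbTE eD).
  by rewrite inE eD.
(* A letter changes only the row [hi e] of the rank function, the row that [rk_lift] recovers. *)
have uw' x b : x != hi e :> nat -> rk u x b <= rk w x b.
  move=> x_hi; apply: leq_trans (uw x b); case: ifP => // _.
  by rewrite rk_swap.
have [eS|eS] := boolP (e \in S).
  by apply: skip => x b; have := uw x b; rewrite eS.
have [w_asc|w_desc] := ltnP (w (lo e)) (w (hi e)).
  by apply: skip; apply: rk_lift w_asc uw'.
pose w' := (tperm (lo e) (hi e) * w)%g.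
have w'_asc : w' (lo e) < w' (hi e).
  rewrite !permM tpermL tpermR ltn_neqAle w_desc andbT.
  rewrite (inj_eq val_inj) (inj_eq (@perm_inj _ w)) -val_eqE /= lo_hi.
  by rewrite neq_ltn ltnSn orbT.
have w'K : (tperm (lo e) (hi e) * w')%g = w by rewrite mulgA tperm2 mul1g.
have [|D [DQ DS wD dD cD]] := IH w' uQ.
  by apply: rk_lift w'_asc _ => // x b x_hi; rewrite [rk w' _ _]rk_swap ?uw'.
have eD : e \notin D by apply: contra eQ => /(subsetP DQ); rewrite inE.
exists (e |: D); split.
- by apply/subsetP => e'; rewrite !inE => /predU1P[->|/(subsetP DQ)];
    rewrite ?eqxx // inE orbC => ->.
- by rewrite disjoints_subset subUset sub1set inE eS -disjoints_subset.
- rewrite /= in_setU1 eqxx (@eq_word_perm _ (mem D)) ?wD //.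
  move=> e' e'Q; rewrite /= in_setU1; case: eqP => // ee'.
  by rewrite -ee' e'Q in eQ.
- rewrite /= (@eq_demazure _ (~: D)) ?dD => [|e' e'Q].
    by rewrite !inE eqxx /= w'_asc w'K.
  by rewrite !inE; case: eqP => // ee'; rewrite -ee' e'Q in eQ.
- by rewrite cardsU1 eD cD -[in RHS]w'K (card_inversions_swap (lo_hi e) w'_asc).
Qed.

End Demazure.

(** * Crossings and the staircase word *)

Local Open Scope nat_scope.

Section Edges.

Variable n : nat.
Implicit Types e f : edge n.

Definition lft e : nat := (val e).1.
Definition rgt e : nat := (val e).2.

Lemma lft_lt_rgt e : lft e < rgt e.
Proof. exact: (valP e). Qed.

Lemma rgt_lt e : rgt e < n.
Proof. exact: ltn_ord. Qed.

Lemma edge_eq e f : lft e = lft f -> rgt e = rgt f -> e = f.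
Proof.
move=> l r; apply/val_inj; rewrite [val e]surjective_pairing.
by rewrite [val f]surjective_pairing; congr (_, _); apply/val_inj.
Qed.

Lemma crossE e f : cross e f =
  [&& lft e < lft f, lft f < rgt e & rgt e < rgt f]
  || [&& lft f < lft e, lft e < rgt f & rgt f < rgt e].
Proof. by rewrite /cross /lft /rgt; case: (val e); case: (val f). Qed.

Lemma crossC e f : cross e f = cross f e.
Proof. by rewrite !crossE orbC. Qed.

(* The edge (i, l) is the box in row i and column n.-1 - l of the ladder; its
   letter is the adjacent transposition of the positions i + (n.-1 - l) and
   i + (n.-1 - l) + 1. *)
Lemma edge_lo_subproof e : n.-1 - (rgt e - lft e) < n.
Proof. by have := rgt_lt e; lia. Qed.

Lemma edge_hi_subproof e : n - (rgt e - lft e) < n.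
Proof. by have := rgt_lt e; have := lft_lt_rgt e; lia. Qed.

Definition lo e : 'I_n := Ordinal (edge_lo_subproof e).
Definition hi e : 'I_n := Ordinal (edge_hi_subproof e).

Lemma lo_hi e : hi e = (lo e).+1 :> nat.
Proof. by have := rgt_lt e; have := lft_lt_rgt e; rewrite /=; lia. Qed.

Definition pairwise_crossing (C : {set edge n}) :=
  forall e f, e \in C -> f \in C -> e != f -> cross e f.

Lemma is_crossingP m (C : {set edge n}) :
  reflect (#|C| = m /\ pairwise_crossing C) (is_crossing m C).
Proof.
apply: (iffP andP) => [[/eqP cC /forall_inP H]|[<- H]]; split=> //.
  by move=> e f eC fC ef; have /forall_inP/(_ f fC)/implyP := H e eC; apply.
apply/forall_inP => e eC; apply/forall_inP => f fC; apply/implyP; exact: H.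
Qed.

Lemma pairwise_crossingS (C C' : {set edge n}) :
  C' \subset C -> pairwise_crossing C -> pairwise_crossing C'.
Proof. by move=> /subsetP CC H e f /CC eC /CC fC; exact: H. Qed.

Lemma crossing_freeP m (S : {set edge n}) :
  reflect (forall C : {set edge n}, C \subset S -> pairwise_crossing C -> #|C| < m)
          (crossing_free m S).
Proof.
apply: (iffP idP) => [/existsPn free C CS crC|H]; last first.
  apply/existsPn => C; apply/negP => /andP[CS /is_crossingP[cC crC]].
  by have := H C CS crC; rewrite cC ltnn.
rewrite ltnNge; apply/negP => le_m.
pose C' := [set e in take m (enum C)].
have C'C : C' \subset C.
  by apply/subsetP => e; rewrite inE => /mem_take; rewrite mem_enum.
have := free C'; rewrite (subset_trans C'C CS) /=; apply/negP; rewrite negbK.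
apply/is_crossingP; split; last exact: pairwise_crossingS crC.
rewrite cardsE (card_uniqP _) ?take_uniq ?enum_uniq // size_takel //.
by rewrite -cardE.
Qed.

Variable e0 : edge n.

(** Total, so that words can be built by recursion on numbers; the values taken from [e0] serve only
    outside the range i < l < n. *)
Definition mkE (i l : nat) : edge n :=
  insubd e0 (insubd (val e0).1 i, insubd (val e0).2 l).

Lemma mkEP i l : i < l -> l < n -> lft (mkE i l) = i /\ rgt (mkE i l) = l.
Proof.
move=> il ln; rewrite /lft /rgt /mkE val_insubd /=.
have -> : (insubd (val e0).1 i < insubd (val e0).2 l).
  by rewrite !val_insubd ln (ltn_trans il ln).
by rewrite /= !val_insubd ln (ltn_trans il ln).
Qed.

Lemma mkE_eta e : mkE (lft e) (rgt e) = e.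
Proof.
by have [l r] := mkEP (lft_lt_rgt e) (rgt_lt e); apply: edge_eq.
Qed.

Fixpoint col_word (base : seq (edge n)) l i :=
  if i is i'.+1 then mkE i' l :: col_word base l i' else base.

(* The head of the word acts last. *)
Fixpoint stair_word l :=
  if l is l'.+1 then col_word (stair_word l') l' l' else [::].

Lemma mem_col_word base l i e : i <= l -> l < n ->
  (e \in col_word base l i) = (rgt e == l) && (lft e < i) || (e \in base).
Proof.
move=> il ln; elim: i il => [|i IH] il /=; first by rewrite ltn0 andbF.
rewrite in_cons (IH (ltnW il)) orbA; congr (_ || _).
have [l' r'] := mkEP il ln.
rewrite ltnS [lft e <= i]leq_eqVlt andb_orr; congr (_ || _).
apply/eqP/andP => [->|[/eqP r /eqP li]]; first by rewrite l' r'.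
by apply: edge_eq; rewrite ?l' ?r'.
Qed.

Lemma mem_stair_word l e : l <= n -> (e \in stair_word l) = (rgt e < l).
Proof.
elim: l => //= l IH ln; rewrite mem_col_word // (IH (ltnW ln)).
rewrite ltnS [rgt e <= l]leq_eqVlt; congr (_ || _).
by case: eqP => //= <-; rewrite lft_lt_rgt.
Qed.

Lemma stair_word_uniq l : l <= n -> uniq (stair_word l).
Proof.
elim: l => //= l IH ln; have ub := IH (ltnW ln).
suff H i : i <= l -> uniq (col_word (stair_word l) l i) by exact: H.
elim: i => [|i IHi] // il /=.
rewrite (IHi (ltnW il)) mem_col_word ?(ltnW il) //.
have [-> ->] := mkEP il ln; rewrite ltnn andbF /= mem_stair_word ?(ltnW ln) //.
by have [_ ->] := mkEP il ln; rewrite ltnn.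
Qed.

Variable S : {set edge n}.
Variable a : nat.

(* The largest size of a crossing in S all of whose edges have their left end
   below [i] and their right end in [a, a + d[. *)
Fixpoint longest d : nat -> nat :=
  if d is d'.+1 then
    fix row i := if i is i'.+1 then
      if mkE i' (a + d') \in S then (longest d' i').+1
      else maxn (row i') (longest d' i'.+1) else 0
  else fun=> 0.

Lemma longest0 d : longest d 0 = 0.
Proof. by case: d. Qed.

Lemma longestS d i : longest d.+1 i.+1 =
  if mkE i (a + d) \in S then (longest d i).+1
  else maxn (longest d.+1 i) (longest d i.+1).
Proof. by []. Qed.

Let dem := demazure lo hi S.

Lemma rk_demazure_letter e Q x b : x != hi e :> nat ->
  rk (dem (e :: Q)) x b = rk (dem Q) x b.
Proof.
by move=> x_hi; rewrite /dem /=; case: ifP => // _; rewrite (rk_swap (lo_hi e)).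
Qed.

(** Edges with right end below [a] have [hi e > n - a], so the row [n - a] keeps its value for the
    identity. *)
Lemma rk_demazure_base l b : l <= a -> a <= n -> b = n - a ->
  rk (dem (stair_word l)) b b = b.
Proof.
move=> la an bE; have -> : rk (dem (stair_word l)) b b = rk (1%g : 'S_n) b b.
  have: {in stair_word l, forall e, b != hi e :> nat}.
    move=> e; rewrite mem_stair_word ?(leq_trans la) // => el.
    have := lft_lt_rgt e; rewrite /= bE; lia.
  elim: (stair_word l) => //= e Q IH H; rewrite rk_demazure_letter.
    by apply: IH => e' e'Q; apply: H; rewrite in_cons e'Q orbT.
  by apply: H; rewrite mem_head.
by rewrite rk1 ?minnn // bE leq_subr.
Qed.

(** Both sides obey the recursion of [longest]: one letter alters one row of the rank function, just
    as one box is added to the table of [longest]. *)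
Lemma rk_demazure d i : a + d <= n -> i <= a ->
  rk (dem (stair_word (a + d))) (n - (a + d) + i) (n - a) =
    n - (a + d) + longest d i.
Proof.
set b := n - a; elim: d i => [|d IH] i ad ia.
  rewrite addn0 in ad *; rewrite /= addn0; apply/eqP.
  rewrite eqn_leq rk_le_col /=.
  apply: (leq_trans (eq_leq (esym (rk_demazure_base (leqnn a) ad (erefl b))))).
  by apply: rk_mono; rewrite leq_addr.
rewrite addnS in ad *; set j := n - _; set l := a + d in IH ad *.
have jE : n - l = j.+1 by rewrite /j; lia.
have {}IH i' : i' <= a ->
    rk (dem (stair_word l)) (j.+1 + i') b = j.+1 + longest d i'.
  by move=> i'a; rewrite -jE IH // ltnW.
(* After [c] letters of the column [l], the rows up to [j + c] hold the values for [d.+1], and the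
   rows from [j.+1 + c] on still those for [d]. *)
suff AB c : c <= l -> let s := dem (col_word (stair_word l) l c) in
    (forall i', i' <= c -> i' <= a -> rk s (j + i') b = j + longest d.+1 i') /\
    (forall i', c <= i' -> i' <= a -> rk s (j.+1 + i') b = j.+1 + longest d i').
  by have [A _] := AB l (leqnn l); apply: A => //;
    rewrite (leq_trans ia) // leq_addr.
elim: c => [|c IHc] cl.
  split=> [i'|i' _]; last exact: IH.
  rewrite leqn0 => /eqP-> _; rewrite !addn0.
  apply/eqP; rewrite eqn_leq rk_le_row /=.
  have jn : j + 1 <= n by rewrite /j; lia.
  have := rk_le_add (dem (stair_word l)) b jn.
  by have := IH 0 (leq0n _); rewrite longest0 !addn0 addn1 => -> /=; lia.
have [A B] := IHc (ltnW cl).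
move: A B; set Q := col_word _ _ _ => A B.
rewrite [col_word _ _ _]/= -/Q; set e := mkE c l.
have [el er] : lft e = c /\ rgt e = l by apply: mkEP.
have hiE : hi e = j.+1 + c :> nat by rewrite /= el er /j; lia.
have loE : lo e = j + c :> nat by have := lo_hi e; rewrite hiE; lia.
cbv zeta; split=> i'; last first.
  by move=> ci i'a; rewrite rk_demazure_letter ?B ?(ltnW ci) // hiE; lia.
move=> i'c i'a; have [i'_le_c|c_lt_i'] := leqP i' c.
  by rewrite rk_demazure_letter ?A // hiE; lia.
have {i'c c_lt_i'} i'E : i' = c.+1 by apply/eqP; rewrite eqn_leq i'c.
rewrite {i'}i'E in i'a *; rewrite longestS -/l -/e addnS -addSn -hiE.
have lo_rk : rk (dem Q) (lo e) b = j + longest d.+1 c.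
  by rewrite loE A // ltnW.
have hi_rk : rk (dem Q) (hi e) b = j.+1 + longest d c.
  by rewrite hiE B // ltnW.
have hi1_rk : rk (dem Q) (hi e).+1 b = j.+1 + longest d c.+1.
  by rewrite hiE -addnS B.
(* A letter outside [S] sorts the values at [lo e] and [hi e] decreasingly, so the row [hi e]
   becomes the larger of the row [lo e] and the next row less one: the [maxn] of [longestS]. *)
have := rkS (dem Q) (lo e) b; rewrite -lo_hi hi_rk lo_rk.
have := rkS (dem Q) (hi e) b; rewrite hi_rk hi1_rk.
have -> : dem (e :: Q) =
    if (e \notin S) && (dem Q (lo e) < dem Q (hi e))
    then (tperm (lo e) (hi e) * dem Q)%g else dem Q by [].
case: (boolP (e \in S)) => eS; first by rewrite hi_rk; lia.
case: ifP => asc; last by rewrite hi_rk; move: asc; lia.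
by rewrite (rk_swap_hi (lo_hi e)) lo_rk; move: asc; lia.
Qed.

(** The recursion is traced back: the edge (i, a + d) crosses all edges with left end below [i] and
    right end in [a, a + d[, because [i < a]. *)
Lemma longest_crossing d i : a + d <= n -> i <= a ->
  exists C : {set edge n}, [/\ C \subset S, #|C| = longest d i,
    pairwise_crossing C
    & forall e, e \in C -> [&& lft e < i, a <= rgt e & rgt e < a + d]].
Proof.
elim: d i => [|d IHd] i ad ia.
  exists set0; rewrite sub0set cards0; split=> // e; first by move=> f; rewrite inE.
  by rewrite inE.
elim: i ia => [|i IHi] ia.
  exists set0; rewrite sub0set cards0; split=> // e; first by move=> f; rewrite inE.
  by rewrite inE.
have ad' : a + d < n by rewrite -addnS.
rewrite longestS; case: ifP => eS; last first.
  have [le|lt] := leqP (longest d.+1 i) (longest d i.+1).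
    have [C [CS cC crC HC]] := IHd i.+1 (ltnW ad') ia.
    exists C; split=> //.
    by move=> e /HC; lia.
  have [C [CS cC crC HC]] := IHi (ltnW ia).
  exists C; split=> //.
  by move=> e /HC; lia.
have [C [CS cC crC HC]] := IHd i (ltnW ad') (ltnW ia).
have i_lt : i < a + d by rewrite (leq_trans ia) ?leq_addr.
set e := mkE i (a + d) in eS *; have [el er] := mkEP i_lt ad'.
rewrite -/e in el er; exists (e |: C).
have eC : e \notin C by apply/negP => /HC; rewrite el ltnn.
have cr f : f \in C -> cross e f.
  by move/HC; rewrite crossE el er; lia.
split.
- by rewrite subUset sub1set eS.
- by rewrite cardsU1 eC cC.
- move=> f g; rewrite !in_setU1 => /predU1P[->|fC] /predU1P[->|gC] fg.
  + by rewrite eqxx in fg.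
  + exact: cr.
  + by rewrite crossC cr.
  + exact: crC.
- by move=> f; rewrite in_setU1 => /predU1P[->|/HC]; rewrite ?el ?er; lia.
Qed.

Lemma crossing_longest d i (C : {set edge n}) : a + d <= n -> i <= a ->
    C \subset S -> pairwise_crossing C ->
    (forall e, e \in C -> [&& lft e < i, a <= rgt e & rgt e < a + d]) ->
  #|C| <= longest d i.
Proof.
elim: d i C => [|d IHd] i C ad ia CS crC HC.
  rewrite leqn0 cards_eq0 -subset0; apply/subsetP => e /HC; lia.
elim: i ia C CS crC HC => [|i IHi] ia C CS crC HC.
  rewrite leqn0 cards_eq0 -subset0; apply/subsetP => e /HC; lia.
have ad' : a + d < n by rewrite -addnS.
have i_lt : i < a + d by rewrite (leq_trans ia) ?leq_addr.
have [el er] := mkEP i_lt ad'; set e := mkE i (a + d) in el er.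
(* Of two crossing edges one has both the larger left end and the larger right end, so the other has
   neither left end [i] nor right end [a + d]. *)
have le1 : #|[set f in C | (lft f == i) || (rgt f == a + d)]| <= 1.
  apply/card_le1_eqP => f g; rewrite !inE => /andP[fC f1] /andP[gC g1].
  apply/eqP; apply: contraTT isT => fg.
  have := crC g f gC fC fg; rewrite crossE.
  have := HC f fC; have := HC g gC; lia.
rewrite longestS -/e; case: ifP => eS.
  rewrite -(cardsID [set f in C | (lft f == i) || (rgt f == a + d)] C).
  rewrite -[X in _ <= X]add1n; apply: leq_add.
    by apply: leq_trans le1; apply: subset_leq_card; apply/subsetP => f;
      rewrite !inE => /andP[_].
  have sub : C :\: [set f in C | (lft f == i) || (rgt f == a + d)] \subset C.
    exact: subsetDl.
  apply: IHd => //; [exact: ltnW|exact: ltnW|exact: subset_trans CS|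
    exact: pairwise_crossingS crC|].
  by move=> f; rewrite !inE => /andP[H fC]; move: H; rewrite fC;
    have := HC f fC; lia.
rewrite leq_max; apply/orP.
have [/existsP[f /andP[fC /eqP fl]]|noL] :=
    boolP [exists f, (f \in C) && (lft f == i)]; last first.
  left; apply: IHi => //; first exact: ltnW.
  move=> f fC; have := HC f fC.
  by move: noL => /existsPn/(_ f); rewrite fC; lia.
right; apply: IHd => //; first exact: ltnW.
move=> g gC; have := HC g gC => /and3P[-> -> /=].
rewrite addnS ltnS leq_eqVlt => /orP[/eqP gr|//].
move/card_le1_eqP: le1 => /(_ f g); rewrite !inE fC gC fl gr !eqxx orbT /=.
move=> /(_ isT isT) fg; suff : f = e by move=> fe; rewrite -fe (subsetP CS) in eS.
by apply: edge_eq; rewrite ?el ?er // -fg.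
Qed.

End Edges.

(** All edges of a crossing pass over the cut just after its largest left end, so bounding [longest]
    over every cut is enough. *)
Lemma crossing_free_demazure n (e0 : edge n) k (S : {set edge n}) :
  crossing_free k.+1 S <->
  (forall a, a <= n ->
    rk (demazure (@lo n) (@hi n) S (stair_word e0 n)) a (n - a) <= k).
Proof.
have rkE a : a <= n -> rk (demazure (@lo n) (@hi n) S (stair_word e0 n)) a (n - a)
    = longest e0 S a (n - a) a.
  move=> an; have := @rk_demazure n e0 S a (n - a) a.
  by rewrite subnKC // subnn !add0n; apply.
split=> [/crossing_freeP free a an|H].
  rewrite rkE //; have an' : a + (n - a) <= n by rewrite subnKC.
  have [C [CS <- crC _]] := @longest_crossing n e0 S a (n - a) a an' (leqnn a).
  by rewrite -ltnS; apply: free.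
apply/crossing_freeP => C CS crC.
have [->|/set0Pn[f fC]] := eqVneq C set0; first by rewrite cards0.
have [e eC emax] := arg_maxnP (fun e : edge n => lft e) fC.
have an : (lft e).+1 <= n by rewrite (leq_trans (lft_lt_rgt e)) // ltnW ?rgt_lt.
rewrite ltnS; apply: leq_trans (H _ an); rewrite rkE //.
have an' : (lft e).+1 + (n - (lft e).+1) <= n by rewrite subnKC.
apply: crossing_longest => // g gC.
have := emax g gC; rewrite /= subnKC // rgt_lt andbT ltnS => -> /=.
have [->|ge] := eqVneq g e; first exact: lft_lt_rgt.
by have := crC g e gC eC ge; rewrite crossE; have := emax g gC; rewrite /=; lia.
Qed.

(** * Completing a crossing-free set *)

Local Open Scope nat_scope.

Section MiddleReversal.

Variables n k : nat.
Hypothesis kn : k + k <= n.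

Definition rev_mid_nat (i : nat) := if (k <= i) && (i < n - k) then n.-1 - i else i.

Lemma rev_mid_nat_lt (i : 'I_n) : rev_mid_nat i < n.
Proof. by rewrite /rev_mid_nat; have := ltn_ord i; case: ifP; lia. Qed.

Definition rev_mid_ord (i : 'I_n) : 'I_n := Ordinal (rev_mid_nat_lt i).

Lemma rev_mid_ord_inj : injective rev_mid_ord.
Proof.
move=> i j /(congr1 val) /=; rewrite /rev_mid_nat => ij; apply/val_inj => /=.
by move: ij; have := ltn_ord i; have := ltn_ord j; case: ifP; case: ifP; lia.
Qed.

Definition rev_mid : 'S_n := perm rev_mid_ord_inj.

Lemma rev_midE (i : 'I_n) : rev_mid i = rev_mid_nat i :> nat.
Proof. by rewrite permE. Qed.

Lemma rk_rev_mid a b : a <= n -> b <= n ->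
  rk rev_mid a b = minn (minn a b) (k + (a + b - n)).
Proof.
move=> an bn; elim: a an => [|a IH] an; first by rewrite rk0; lia.
rewrite (rkS _ (Ordinal an)) (IH (ltnW an)) rev_midE /= /rev_mid_nat.
by case: ifP; lia.
Qed.

(** Besides the trivial bounds, the antidiagonal [a + b = n] decides: below it by monotonicity,
    above it because a row adds at most one. *)
Lemma rk_le_rev_mid (s : 'S_n) : (forall a, a <= n -> rk s a (n - a) <= k) ->
  forall a b, rk s a b <= rk rev_mid a b.
Proof.
move=> sk; have main a b : a <= n -> b <= n -> rk s a b <= rk rev_mid a b.
  move=> an bn; rewrite rk_rev_mid // !leq_min rk_le_row rk_le_col /=.
  have [ab|ab] := leqP (a + b) n.
    have bna : b <= n - a by lia.
    by apply: leq_trans (rk_mono_r s a bna) _; apply: leq_trans (sk a an) _; lia.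
  have E : n - b + (a + b - n) = a by lia.
  have H : n - b + (a + b - n) <= n by rewrite E.
  have := rk_le_add s b H; rewrite E => /leq_trans; apply.
  rewrite leq_add2r; have nb : n - b <= n by lia.
  by have := sk _ nb; rewrite subKn.
move=> a b; have clip (u : 'S_n) : rk u a b = rk u (minn a n) (minn b n).
  apply: eq_bigr => i _; congr (nat_of_bool (_ && _)).
    by rewrite leq_min ltn_ord andbT.
  by rewrite leq_min ltn_ord andbT.
by rewrite !clip; apply: main; rewrite geq_minr.
Qed.

End MiddleReversal.

(** The letters of [D] have Demazure product [rev_mid kn], so the complement of [D] is again
    crossing-free. It contains [S], and its size does not depend on [S]. *)
Lemma crossing_free_extend n (e0 : edge n) k (S : {set edge n}) (kn : k + k <= n) :
    crossing_free k.+1 S ->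
  exists D : {set edge n}, [/\ [disjoint D & S],
    word_perm (@lo n) (@hi n) (mem D) (stair_word e0 n) = rev_mid kn,
    crossing_free k.+1 (~: D) & #|D| = #|inversions (rev_mid kn)|].
Proof.
move=> /(crossing_free_demazure e0)/(rk_le_rev_mid kn).
move=> /(demazure_subword (@lo_hi n) (stair_word_uniq e0 (leqnn n))).
move=> [D [_ DS wD dD cD]]; exists D; split=> //.
apply/(crossing_free_demazure e0) => a an; rewrite dD rk_rev_mid // ?leq_subr //.
lia.
Qed.

Local Open Scope ring_scope.

(** * The ladder inside the staircase product *)

Section StaircaseMatrix.

Variables (n : nat) (e0 : edge n) (R : comNzRingType) (c : edge n -> R).

Let W l := word_mx (@lo n) (@hi n) c (stair_word e0 l).

Lemma letter_mxE (q q' : 'I_n) (x : R) (A : 'M_n) (r b : 'I_n) : q != q' ->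
  (letter_mx q q' x *m A) r b =
    if r == q then A q' b + x * A q b else if r == q' then A q b else A r b.
Proof.
move=> qq'; rewrite mul_letter_mx; have [->|rq] := eqVneq r q.
  by rewrite tpermL mul1r.
have [->|rq'] := eqVneq r q'; first by rewrite tpermR !mul0r addr0.
by rewrite tpermD ?[q == _]eq_sym ?[q' == _]eq_sym // !mul0r addr0.
Qed.

(** Outside the last [l] rows and columns the product is still the identity; a new column of letters
    moves rows up by one and puts its parameters into the column [n - l.+1]. *)
Lemma stair_mx l : (l <= n)%N -> forall r b : 'I_n,
  ((r < n - l)%N || (b < n - l)%N -> W l r b = (r == b)%:R) /\
  (forall i, (n - l <= b)%N -> (i < n.-1 - b)%N -> r = (n - l + i)%N :> nat ->
     W l r b = c (mkE e0 i (n.-1 - b))).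
Proof.
elim: l => [|l IH] ln r b.
  split=> [_|i]; first by rewrite /W /= mxE.
  by rewrite subn0 leqNgt ltn_ord.
have {}IH := IH (ltnW ln).
pose j := (n - l.+1)%N; have jE : (n - l = j.+1)%N by rewrite /j; lia.
have jn : (j < n)%N by rewrite /j; lia.
have W1 (r' b' : 'I_n) : (r' <= j)%N || (b' <= j)%N -> W l r' b' = (r' == b')%:R.
  by move=> rb; have [-> //] := IH r' b'; rewrite jE !ltnS.
(* After [i] letters the unit row that started at [j] has moved down to [j + i], and the rows it
   passed have moved up by one. *)
suff H i : (i <= l)%N -> forall r b : 'I_n,
    word_mx (@lo n) (@hi n) c (col_word e0 (stair_word e0 l) l i) r b =
    if (r < j)%N then (r == b)%:R else
    if (r < j + i)%N then
      W l (insubd r r.+1) b + c (mkE e0 (r - j) l) * (b == j :> nat)%:R else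
    if r == (j + i)%N :> nat then (b == j :> nat)%:R else W l r b.
  rewrite {1 2}/W /= (H l (leqnn l)) -/j; split=> [rb|i bj ib rE].
    case: (ltnP r j) rb => //= jr bj.
    have rb : (r == b) = false.
      by rewrite -val_eqE /= gtn_eqF // (leq_trans bj).
    have -> : (b == j :> nat) = false by rewrite ltn_eqF.
    rewrite rb mulr0 addr0; case: ifP => rl; last first.
      by case: ifP => // rjl; have := ltn_ord r; move: rl rjl; rewrite /j; lia.
    have r1 : (r.+1 < n)%N by move: rl; rewrite /j; lia.
    rewrite W1 ?(ltnW bj) ?orbT // -val_eqE /= val_insubd r1 gtn_eqF //.
    by rewrite (leq_trans bj) // (leq_trans jr) // ltnW.
  have r1 : (r.+1 < n)%N by rewrite rE; lia.
  have -> : (r < j)%N = false by rewrite rE; lia.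
  have -> : (r < j + l)%N by rewrite rE; rewrite /j in bj *; lia.
  have rji : (r - j)%N = i by rewrite rE addKn.
  rewrite rji; have [bj'|bj'] := eqVneq (b : nat) j.
    rewrite W1 ?bj' ?leqnn ?orbT // -val_eqE /= val_insubd r1 bj' gtn_eqF.
      by rewrite add0r mulr1; congr (c (mkE e0 _ _)); rewrite /j; lia.
    by rewrite rE; lia.
  rewrite mulr0 addr0; have [_] := IH (insubd r r.+1) b; apply=> //.
    by rewrite jE ltn_neqAle eq_sym bj'.
  by rewrite val_insubd r1 jE rE.
elim: i => [|i IHi] il {}r {}b.
  rewrite addn0 /=; have [rj|jr] := ltnP r j.
    by rewrite -/(W l) W1 // (ltnW rj).
  have [rj|//] := eqVneq (r : nat) j.
  by rewrite -/(W l) W1 ?rj ?leqnn // -val_eqE /= rj eq_sym.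
have [el er] := mkEP e0 il ln.
set e := mkE e0 i l in el er.
have loE : lo e = (j + i)%N :> nat by rewrite /= el er /j; lia.
have hiE : hi e = (j + i).+1 :> nat by rewrite lo_hi loE.
have lohi : lo e != hi e.
  by apply/eqP => /(congr1 (@nat_of_ord n)); rewrite loE hiE; lia.
have -> : word_mx (@lo n) (@hi n) c (col_word e0 (stair_word e0 l) l i.+1) =
  letter_mx (lo e) (hi e) (c e) *m
    word_mx (@lo n) (@hi n) c (col_word e0 (stair_word e0 l) l i) by [].
have {}IHi := IHi (ltnW il).
have Alo b' : word_mx (@lo n) (@hi n) c (col_word e0 (stair_word e0 l) l i)
    (lo e) b' = (b' == j :> nat)%:R.
  by rewrite IHi loE ltnNge leq_addr /= ltnn eqxx.
rewrite letter_mxE // Alo -!val_eqE [val (lo e)]loE [val (hi e)]hiE.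
have [rlo|rlo] := eqVneq (val r) (j + i)%N.
  rewrite IHi hiE rlo; have -> : ((j + i).+1 < j)%N = false by lia.
  have -> : ((j + i).+1 < j + i)%N = false by lia.
  have -> : ((j + i).+1 == j + i)%N = false by lia.
  have -> : (j + i < j)%N = false by lia.
  have -> : (j + i < j + i.+1)%N by lia.
  rewrite addKn -/e; congr (W l _ b + _); apply/val_inj.
  by rewrite val_insubd -hiE ltn_ord.
have [rhi|rhi] := eqVneq (val r) (j + i).+1.
  rewrite rhi; have -> : ((j + i).+1 < j)%N = false by lia.
  have -> : ((j + i).+1 < j + i.+1)%N = false by lia.
  by rewrite addnS eqxx.
rewrite IHi (negbTE rlo) addnS (negbTE rhi) ltnS [(r <= j + i)%N]leq_eqVlt.
by rewrite (negbTE rlo).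
Qed.

Lemma stair_mx_entry (r b : 'I_n) : (r < n.-1 - b)%N ->
  word_mx (@lo n) (@hi n) c (stair_word e0 n) r b = c (mkE e0 r (n.-1 - b)).
Proof.
by move=> rb; have [_] := stair_mx (leqnn n) r b; apply; rewrite ?subnn ?add0n.
Qed.

End StaircaseMatrix.

(** On the cell of [rev_mid] the entry (v, v') is the sum of [L v s * V (w s) (rev_ord v')]. A
    nonzero term needs [s <= v] and [w s <= rev_ord v']; this gives [v' <= s <= v] for [s] in the
    reversed middle and [v' < k <= s <= v] for [s >= n - k], both against [v < v']. So only [s < k]
    contribute. *)
Lemma rank_k_dense (F : fieldType) (n k : nat) (S : {set edge n})
    (p : edge_poly F n) :
    (forall s : seq F, exists x, x \notin s) -> (k + k <= n)%N ->
    crossing_free k.+1 S -> only_involves S p -> p != 0 ->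
  exists (A B : 'I_k -> 'I_n -> F),
    p.@[fun i => let e := val (enum_val i) in \sum_r A r e.1 * B r e.2] != 0.
Proof.
move=> F_inf kn free pS p0.
have [e0 _|no_edge] := pickP (fun _ : edge n => true); last first.
  exists (fun _ _ => 0), (fun _ _ => 0).
  have [x px] := mpoly_nonvanishing F_inf p0.
  rewrite (meval_eq (v2 := x)) // => i.
  by have := no_edge (enum_val i).
have [D [DS wD _ _]] := crossing_free_extend e0 kn free.
have [||x [L [U [[lL dL] uU WU]]] px] :=
  in_cell_dense (@lo_hi n) F_inf (D := mem D) (Q := stair_word e0 n) _ p0.
- exact: stair_word_uniq.
- move=> m e mp _ eD; apply/eqP.
  by have [//|/(pS _ _ mp)] := boolP (m _ == 0%N); rewrite (disjointFr DS eD).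
have [V UV uV] := upper_unitri_inv uU.
rewrite {}wD in WU; set w := rev_mid kn in WU.
have k_le_n : (k <= n)%N by apply: leq_trans (leq_addr k k) kn.
exists (fun r v => L v (widen_ord k_le_n r)).
exists (fun r v => V (widen_ord k_le_n r) (rev_ord v)).
rewrite (meval_eq (v2 := x \o enum_val)) // => i /=.
set e := enum_val i; set v := (val e).1; set v' := (val e).2.
have vv' : (v < v')%N := lft_lt_rgt e.
have v'E : (n.-1 - rev_ord v')%N = v' by rewrite /=; have := ltn_ord v'; lia.
have -> : x e = word_mx (@lo n) (@hi n) x (stair_word e0 n) v (rev_ord v').
  by rewrite stair_mx_entry v'E // -[in LHS](mkE_eta e0 e).
rewrite -[word_mx _ _ _ _]mulmx1 -UV mulmxA WU -mulmxA -row_permE mxE.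
have -> : \sum_(r < k) L v (widen_ord k_le_n r)
      * V (widen_ord k_le_n r) (rev_ord v') =
    \sum_(r < n | (r < k)%N) L v r * V r (rev_ord v').
  by rewrite (big_ord_narrow k_le_n).
symmetry; rewrite [RHS]big_mkcond; apply: eq_bigr => s _; rewrite mxE.
have [vs|sv] := ltnP v s; first by rewrite lL // !mul0r if_same.
have [ws|ws] := ltnP (rev_ord v') (w s).
  rewrite (uV _ _ ws) mulr0; case: ifP => // sk.
  move: ws; rewrite rev_midE /rev_mid_nat [(k <= s)%N]leqNgt sk /= => ws.
  by rewrite uV ?mulr0.
move: ws; rewrite {1}/w rev_midE /rev_mid_nat /= => ws.
have sk : (s < k)%N by move: ws; have := ltn_ord v'; case: ifP; lia.
rewrite sk; congr (_ * V _ _); apply/val_inj.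
by rewrite /= rev_midE /rev_mid_nat [(k <= s)%N]leqNgt sk.
Qed.

(** * Perfect matchings *)

Local Open Scope ring_scope.

(** The terms at [i] and [t i] cancel. Vanishing at fixed points is a separate hypothesis, since
    [F i = - F i] does not give it in characteristic two. *)
Lemma sum_sign_reversing (I : finType) (V : zmodType) (P : pred I) (F : I -> V)
    (t : I -> I) : involutive t ->
    (forall i, P i -> P (t i)) -> (forall i, P i -> F (t i) = - F i) ->
    (forall i, P i -> t i = i -> F i = 0) ->
  \sum_(i | P i) F i = 0.
Proof.
move=> tK Pt Ft F0; have PtE i : P (t i) = P i.
  by apply/idP/idP => [/Pt|/Pt //]; rewrite tK.
rewrite (bigID (fun i => enum_rank i < enum_rank (t i))%N) /=.
rewrite [X in _ + X](bigID (fun i => t i == i)) /= [X in _ + (X + _)]big1.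
  rewrite add0r [X in _ + X](reindex_inj (inv_inj tK)) /= -[RHS](subrr
    (\sum_(i | P i && (enum_rank i < enum_rank (t i))%N) F i)).
  congr (_ + _); rewrite -sumrN; apply: eq_big => [i|i].
    rewrite PtE tK -andbA; congr (_ && _).
    rewrite eq_sym -(inj_eq enum_rank_inj) -val_eqE /=.
    by case: ltngtP.
  by rewrite PtE => /andP[/andP[/Ft-> _] _].
by move=> i /andP[/andP[Pi _] /eqP]; exact: F0.
Qed.

Section Matchings.

Variable n : nat.
Implicit Types (e f g : edge n) (E : {set edge n}) (U : {set 'I_n}).

Local Notation ends := (@edge_ends n).

Lemma ends_neq e : (val e).1 != (val e).2.
Proof. by rewrite -val_eqE neq_ltn (lft_lt_rgt e). Qed.

Lemma ends2P e x y : ends e = [set x; y] ->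
  ((val e).1 = x /\ (val e).2 = y) \/ ((val e).1 = y /\ (val e).2 = x).
Proof.
rewrite /edge_ends => E; have ne := ends_neq e.
have /set2P A : (val e).1 \in [set x; y] by rewrite -E set21.
have /set2P B : (val e).2 \in [set x; y] by rewrite -E set22.
case: A B ne => [->|->] [->|->]; rewrite ?eqxx //; by [left|right].
Qed.

Lemma ends_inj : injective ends.
Proof.
move=> e f ef; have := lft_lt_rgt e; have := lft_lt_rgt f.
have [[l r]|[l r]] := ends2P ef; last by rewrite /lft /rgt l r; lia.
by move=> _ _; apply: edge_eq; rewrite /lft /rgt ?l ?r.
Qed.

Lemma endsP e x : x \in ends e -> exists2 y, x != y & ends e = [set x; y].
Proof.
have := ends_neq e; rewrite !inE => ne /orP[]/eqP->; first by exists (val e).2.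
by exists (val e).1; rewrite 1?eq_sym // /edge_ends setUC.
Qed.

Lemma ends_neq2 e x y : ends e = [set x; y] -> x != y.
Proof.
by have := ends_neq e; move=> ne /ends2P[[<- <-]|[<- <-]] //; rewrite eq_sym.
Qed.

Lemma perfect_matchingP U E :
  reflect [/\ forall e, e \in E -> ends e \subset U,
              forall v, v \in U -> exists2 e, e \in E & v \in ends e
            & forall e f v, e \in E -> f \in E ->
                v \in ends e -> v \in ends f -> e = f]
          (perfect_matching U E).
Proof.
apply: (iffP and3P) => [[/eqP cov /trivIsetP triv _]|[sub cov uni]]; split.
- by move=> e eE; rewrite -cov; apply: (bigcup_max (ends e)) => //; exact: imset_f.
- move=> v; rewrite -cov => /bigcupP[A /imsetP[e eE ->] ve]; by exists e.
- move=> e f v eE fE ve vf; apply/eqP; apply: contraT => ef.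
  have := triv _ _ (imset_f ends eE) (imset_f ends fE).
  rewrite (inj_eq ends_inj) => /(_ ef) /pred0P/(_ v); by rewrite /= ve vf.
- rewrite eqEsubset; apply/andP; split.
    by apply/bigcupsP => A /imsetP[e eE ->]; exact: sub.
  apply/subsetP => v /cov[e eE ve]; apply/bigcupP; exists (ends e) => //.
  exact: imset_f.
- apply/trivIsetP => A B /imsetP[e eE ->] /imsetP[f fE ->] ef.
  rewrite -setI_eq0; apply: contraR ef => /set0Pn[v]; rewrite inE => /andP[ve vf].
  by rewrite (uni e f v).
- apply/negP => /imsetP[e _ /setP/(_ (val e).1)]; by rewrite !inE eqxx.
Qed.

Lemma pm_ends U E e v :
  perfect_matching U E -> e \in E -> v \in ends e -> v \in U.
Proof. by case/perfect_matchingP => H _ _ /H/subsetP; apply. Qed.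

Lemma pm_inj U E e f v : perfect_matching U E -> e \in E -> f \in E ->
  v \in ends e -> v \in ends f -> e = f.
Proof. by case/perfect_matchingP => _ _; apply. Qed.

Lemma pm_edge U E v : perfect_matching U E -> v \in U ->
  exists2 e, e \in E & v \in ends e.
Proof. by case/perfect_matchingP => _ H _; apply: H. Qed.

Lemma pm_big (R : Type) (idx : R) (op : Monoid.com_law idx) U E (F : 'I_n -> R) :
  perfect_matching U E ->
  \big[op/idx]_(v in U) F v =
    \big[op/idx]_(e in E) op (F (val e).1) (F (val e).2).
Proof.
move=> pm; rewrite (set_partition_big _ pm) big_imset /=; last first.
  by move=> e f _ _; exact: ends_inj.
apply: eq_bigr => e _; rewrite /edge_ends big_setU1 ?big_set1 //.
by rewrite in_set1 ends_neq.
Qed.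

Lemma cr_setU1 e E : e \notin E -> cr (e |: E) = (cr E + \sum_(f in E) cross e f)%N.
Proof.
move=> eE; rewrite /cr.
pose A := [set C : {set edge n} | (C \subset E) && is_crossing 2 C].
pose B := [set f in E | cross e f].
pose h f : {set edge n} := [set e; f].
have crh f : f \in E -> is_crossing 2 (h f) = cross e f.
  move=> fE; have ef : e != f by apply: contraNneq eE => ->.
  apply/is_crossingP/idP => [[_ /(_ e f)]|cef].
    by rewrite set21 set22 => /(_ isT isT ef).
  split; first by rewrite cards2 ef.
  move=> f1 f2; rewrite !inE => /orP[]/eqP-> /orP[]/eqP-> //; rewrite ?eqxx //.
  by rewrite crossC.
have -> : [set C : {set edge n} | (C \subset e |: E) && is_crossing 2 C]
   = A :|: h @: B.
  apply/setP => C; rewrite !inE; apply/idP/idP.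
    move=> /andP[CE crC]; have [eC|eC] := boolP (e \in C); last first.
      apply/orP; left; rewrite crC andbT; apply/subsetP => f fC.
      have := subsetP CE f fC; rewrite in_setU1 => /predU1P[fe|//].
      by rewrite -fe fC in eC.
    apply/orP; right; have /is_crossingP[/eqP cC _] := crC.
    have := cardsD1 e C; rewrite eC (eqP cC) => -[/esym/eqP/cards1P[f Cf]].
    have CE' : C = h f by rewrite -(setD1K eC) Cf.
    have fE : f \in E.
      have : f \in C :\ e by rewrite Cf set11.
      rewrite in_setD1 => /andP[fe /(subsetP CE)].
      by rewrite in_setU1 (negbTE fe).
    by rewrite CE'; apply: imset_f; rewrite inE fE -(crh f fE) -CE'.
  move=> /orP[/andP[CE ->]|/imsetP[f]].
    by rewrite (subset_trans CE) // subsetUr.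
  rewrite inE => /andP[fE cef] ->; rewrite crh // cef andbT.
  by rewrite subUset !sub1set !in_setU1 eqxx fE orbT.
rewrite cardsU [A :&: _](_ : _ = set0).
  rewrite cards0 subn0; congr (_ + _)%N; rewrite card_in_imset.
    rewrite -sum1_card big_mkcond [RHS]big_mkcond /=; apply: eq_bigr => f _.
    by rewrite inE; case: (f \in E) => //=; case: (cross e f).
  move=> f f'; rewrite !inE => /andP[fE _] _ /setP/(_ f); rewrite !inE eqxx orbT.
  move=> /esym/orP[/eqP fe|/eqP //]; by rewrite -fe fE in eE.
apply/setP => C; rewrite !inE; apply/negP => /andP[/andP[CE _] /imsetP[f _ CE']].
by rewrite CE' subUset sub1set (negbTE eE) in CE.
Qed.

(** * Vertex permutations acting on edges and matchings *)

Section EdgePermutation.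

Variable s : 'S_n.

(** The default [e] is never taken, as [s] is injective and the ends are distinct. *)
Definition eperm e : edge n :=
  insubd e (if (s (val e).1 < s (val e).2)%N then (s (val e).1, s (val e).2)
            else (s (val e).2, s (val e).1)).

Lemma ends_eperm e : ends (eperm e) = s @: ends e.
Proof.
have ne : s (val e).1 != s (val e).2 by rewrite (inj_eq perm_inj) ends_neq.
rewrite /edge_ends imsetU1 imset_set1 /eperm val_insubd /=.
case: (ltngtP (s (val e).1) (s (val e).2)) => H /=; rewrite ?H //.
  by rewrite setUC.
by case/eqP: ne; apply: val_inj.
Qed.

Lemma pm_eperm U E : s @: U = U -> perfect_matching U E ->
  perfect_matching U (eperm @: E).
Proof.
move=> sU pm; apply/perfect_matchingP; split.
- move=> _ /imsetP[e eE ->]; rewrite ends_eperm -sU imsetS //.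
  by apply/subsetP => v; exact: pm_ends eE.
- move=> v; rewrite -{1}sU => /imsetP[u uU ->].
  have [e eE ue] := pm_edge pm uU; exists (eperm e); first exact: imset_f.
  by rewrite ends_eperm imset_f.
- move=> _ _ v /imsetP[e eE ->] /imsetP[f fE ->]; rewrite !ends_eperm.
  move=> /imsetP[x xe ->] /imsetP[y yf /perm_inj xy]; rewrite -xy in yf.
  by rewrite (pm_inj pm eE fE xe yf).
Qed.

End EdgePermutation.

Section Transposition.

Variables a b : 'I_n.
Let t := tperm a b.

Lemma epermK_tperm : involutive (eperm t).
Proof.
move=> e; apply: ends_inj; rewrite !ends_eperm -imset_comp.
rewrite -[RHS]imset_id; apply: eq_imset => x /=; exact: tpermK.
Qed.

Lemma eperm_set_tpermK : involutive (fun E => eperm t @: E).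
Proof.
move=> E; rewrite -imset_comp -[RHS]imset_id.
by apply: eq_imset => e /=; exact: epermK_tperm.
Qed.

Lemma tperm_setE U : a \in U -> b \in U -> t @: U = U.
Proof.
move=> aU bU; apply/eqP; rewrite eqEcard card_imset ?leqnn ?andbT; last first.
  exact: perm_inj.
apply/subsetP => _ /imsetP[x xU ->]; by rewrite /t; case: tpermP.
Qed.

Lemma eperm_tperm_id e : a \notin ends e -> b \notin ends e -> eperm t e = e.
Proof.
move=> ae be; apply: ends_inj; rewrite ends_eperm -[RHS]imset_id.
apply: eq_in_imset => x xe; rewrite /t tpermD //.
  by apply: contraNneq ae => ->.
by apply: contraNneq be => ->.
Qed.

Lemma ends_eperm_tperml e x : b != x -> ends e = [set a; x] ->
  ends (eperm t e) = [set b; x].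
Proof.
move=> bx eE; have ax := ends_neq2 eE; rewrite ends_eperm eE imsetU1 imset_set1.
by rewrite /t tpermL tpermD.
Qed.

Lemma ends_eperm_tpermr e x : a != x -> ends e = [set b; x] ->
  ends (eperm t e) = [set a; x].
Proof.
move=> ax eE; have bx := ends_neq2 eE; rewrite ends_eperm eE imsetU1 imset_set1.
by rewrite /t tpermR tpermD.
Qed.

End Transposition.

(** For [v] not an end of [g]: whether [v] lies between the ends. Edges without a common end cross
    exactly if one end of the first lies between the ends of the second and the other does not. *)
Definition side (v : 'I_n) g : bool := (v < (val g).1)%N (+) (v < (val g).2)%N.

Lemma sideE v g x y : ends g = [set x; y] -> side v g = (v < x)%N (+) (v < y)%N.
Proof. by rewrite /side => /ends2P[[-> ->]|[-> ->]] //; rewrite addbC. Qed.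

Lemma cross_side e g x y :
  ends e = [set x; y] -> x \notin ends g -> y \notin ends g ->
  cross e g = side x g (+) side y g.
Proof.
move=> eE; have := lft_lt_rgt e; have := lft_lt_rgt g; rewrite crossE /side !inE.
rewrite /lft /rgt -!val_eqE.
have [[-> ->]|[-> ->]] := ends2P eE; move=> /= H1 H2 H3 H4; lia.
Qed.

End Matchings.

(** * The Pfaffian is alternating *)

Local Open Scope ring_scope.

Section Pfaffian.

Variables (n : nat) (R : comNzRingType).
Implicit Types (e f g : edge n) (E G : {set edge n}) (U : {set 'I_n}).
Implicit Types Y : 'I_n -> 'I_n -> R.

Local Notation ends := (@edge_ends n).

Definition pf_term Y E : R :=
  (-1) ^+ cr E * \prod_(e in E) Y (val e).1 (val e).2.

Definition pf Y U : R := \sum_(E | perfect_matching U E) pf_term Y E.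

(** The diagonal is left free, so that in [set_row] a row can be replaced by any vector. *)
Definition antisym Y := forall x y, x != y -> Y x y = - Y y x.

Lemma antisym_edge Y e x y : antisym Y -> ends e = [set x; y] ->
  Y (val e).1 (val e).2 = (-1) ^+ (y < x)%N * Y x y.
Proof.
move=> aY eE; have := lft_lt_rgt e; rewrite /lft /rgt.
have [[-> ->]|[-> ->]] := ends2P eE => xy; first by rewrite ltnNge ltnW ?mul1r.
by rewrite xy mulN1r aY // -val_eqE /= ltn_eqF.
Qed.

Let side_prod G v : R := \prod_(g in G) (-1) ^+ side v g.

Lemma sign_cross_sum G e x y : ends e = [set x; y] ->
    {in G, forall g, x \notin ends g /\ y \notin ends g} ->
  (-1) ^+ (\sum_(g in G) cross e g)%N = side_prod G x * side_prod G y.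
Proof.
move=> eE eG; rewrite -prodrXr -big_split /=; apply: eq_bigr => g /eG[xg yg].
by rewrite (cross_side eE xg yg) signr_addb.
Qed.

(** Makes the terms before and after a swap comparable: crossings with [G] enter by one sign per
    end, and the six comparisons record the crossing of [e] with [f] and the orientation of both. *)
Lemma pf_term_two Y G e f x y z w : antisym Y ->
    ends e = [set x; y] -> ends f = [set z; w] ->
    e \notin f |: G -> f \notin G ->
    x \notin ends f -> y \notin ends f ->
    {in G, forall g, x \notin ends g /\ y \notin ends g} ->
    {in G, forall g, z \notin ends g /\ w \notin ends g} ->
  pf_term Y (e |: (f |: G)) =
    (-1) ^+ cr G * (side_prod G x * side_prod G y * side_prod G z * side_prod G w)
    * (-1) ^+ ((x < z)%N (+) (x < w)%N (+) (y < z)%N (+) (y < w)%N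
               (+) (y < x)%N (+) (w < z)%N)
    * (Y x y * Y z w) * \prod_(g in G) Y (val g).1 (val g).2.
Proof.
move=> aY eE fE eG fG xf yf xyG zwG.
rewrite /pf_term !cr_setU1 // !big_setU1 //= !exprD.
rewrite (sign_cross_sum eE xyG) (sign_cross_sum fE zwG).
rewrite (cross_side eE xf yf) !(sideE _ fE).
rewrite (antisym_edge aY eE) (antisym_edge aY fE).
move: (x < z)%N (x < w)%N (y < z)%N (y < w)%N (y < x)%N (w < z)%N.
move=> c1 c2 c3 c4 c5 c6.
have -> : (-1) ^+ (c1 (+) c2 (+) c3 (+) c4 (+) c5 (+) c6) =
    (-1) ^+ (c1 (+) c2 (+) (c3 (+) c4)) * (-1) ^+ c5 * (-1) ^+ c6 :> R.
  by rewrite -!signr_addb !addbA.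
move: (side_prod G x) (side_prod G y) (side_prod G z) (side_prod G w).
move: (Y x y) (Y z w) (\prod_(_ in _) _) => y1 y2 p s1 s2 s3 s4.
move: (_ ^+ cr G) (_ ^+ addb _ _) (_ ^+ c5) (_ ^+ c6) => m1 m2 m3 m4; ring.
Qed.

(** Swapping [a] and [b] in a matching without the edge {a, b} reverses the sign of its term; a
    matching with this edge has term 0. *)
Lemma pf_alternating Y U a b : antisym Y -> a != b -> a \in U -> b \in U ->
    Y a b = 0 -> (forall v, v != a -> v != b -> Y a v = Y b v) ->
  pf Y U = 0.
Proof.
move=> aY ab aU bU Yab0 Yab; pose t := tperm a b.
have matched E e : e \in E -> ends e = [set a; b] -> pf_term Y E = 0.
  move=> eE endsE; rewrite /pf_term (bigD1 e) //= (antisym_edge aY endsE) Yab0.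
  by rewrite mulr0 mul0r mulr0.
have tU := tperm_setE aU bU.
pose matchedb E := [exists e in E, ends e == [set a; b]].
have split E : perfect_matching U E -> matchedb E = false ->
    pf_term Y (eperm t @: E) = - pf_term Y E /\ eperm t @: E != E.
  move=> pm /negbT/exists_inPn unm.
  have [e eE ae] := pm_edge pm aU; have [f fE bf] := pm_edge pm bU.
  have [u au endse] := endsP ae; have [v bv endsf] := endsP bf.
  have bu : b != u by apply: contraNneq (unm e eE) => ->; rewrite endse.
  have av : a != v.
    by apply: contraNneq (unm f fE) => ->; rewrite endsf setUC.
  have ef : e != f.
    apply: contraTneq bf => <-; rewrite endse !inE negb_or bu andbT.
    by rewrite eq_sym.
  have disj x : x \in ends e -> x \notin ends f.
    by move=> xe; apply: contra ef => xf; apply/eqP; exact: pm_inj pm eE fE xe xf.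
  have uv : u != v.
    apply: contraTneq (disj u _); rewrite ?endse ?set22 // => uv.
    by rewrite endsf uv set22.
  pose G := E :\ e :\ f.
  have EE : E = e |: (f |: G).
    by rewrite /G setD1K ?setD1K // in_setD1 eq_sym ef.
  have eG : e \notin f |: G by rewrite !inE negb_or ef eqxx.
  have fG : f \notin G by rewrite !inE eqxx.
  have Ge x : x \in ends e -> {in G, forall g, x \notin ends g}.
    move=> xe g; rewrite !in_setD1 => /and3P[gf ge gE].
    by apply: contra ge => xg; apply/eqP; exact: pm_inj pm gE eE xg xe.
  have Gf x : x \in ends f -> {in G, forall g, x \notin ends g}.
    move=> xf g; rewrite !in_setD1 => /and3P[gf ge gE].
    by apply: contra gf => xg; apply/eqP; exact: pm_inj pm gE fE xg xf.
  have ue : u \in ends e by rewrite endse set22.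
  have vf : v \in ends f by rewrite endsf set22.
  have GG : eperm t @: G = G.
    rewrite -[RHS]imset_id; apply: eq_in_imset => g gG.
    by rewrite /t eperm_tperm_id ?(Ge a) ?(Gf b).
  have endse' : ends (eperm t e) = [set b; u] by apply: ends_eperm_tperml.
  have endsf' : ends (eperm t f) = [set a; v] by apply: ends_eperm_tpermr.
  have E'E : eperm t @: E = eperm t e |: (eperm t f |: G).
    by rewrite {1}EE !imsetU1 GG.
  have e'f' : eperm t e != eperm t f.
    by rewrite (inj_eq (inv_inj (epermK_tperm a b))).
  have e'G : eperm t e \notin eperm t f |: G.
    rewrite in_setU1 (negbTE e'f') /=; apply/negP => /(Gf b bf).
    by rewrite endse' set21.
  have f'G : eperm t f \notin G.
    by apply/negP => /(Ge a ae); rewrite endsf' set21.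
  split; last first.
    apply/eqP => EqE; have e'E : eperm t e \in E by rewrite -EqE imset_f.
    have : eperm t e = e by apply: (pm_inj pm e'E eE _ ue); rewrite endse' set22.
    move=> e'e; have : b \in ends e by rewrite -e'e endse' set21.
    by apply/negP; apply: contraL bf; exact: disj.
  have bf' : b \notin ends (eperm t f).
    by rewrite endsf' !inE negb_or eq_sym ab.
  have uf' : u \notin ends (eperm t f).
    by rewrite endsf' !inE negb_or eq_sym au.
  rewrite E'E {1}EE.
  rewrite (pf_term_two aY endse' endsf') //; last 2 first.
  - by move=> g gG; rewrite (Gf b) ?(Ge u).
  - by move=> g gG; rewrite (Gf v) ?(Ge a).
  rewrite (pf_term_two aY endse endsf) //; last 4 first.
  - exact: disj.
  - exact: disj.
  - by move=> g gG; rewrite (Ge a) ?(Ge u).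
  - by move=> g gG; rewrite (Gf v) ?(Gf b).
  rewrite -(Yab u) 1?eq_sym // -(Yab v) 1?eq_sym //.
  set s1 := (-1) ^+ (_ (+) _); set s2 := (-1) ^+ (_ (+) _).
  (* The comparisons of [a] with [b], of [a] with [v] and of [b] with [v] are reversed; three
     reversals change the sign. *)
  suff -> : s1 = - s2.
    move: (side_prod _ _) (side_prod _ _) (side_prod _ _) (side_prod _ _).
    move: (_ ^+ cr G) s2 (Y _ _) (Y _ _) (\prod_(_ in _) _) => *; ring.
  rewrite /s1 /s2 -signrN; congr ((-1) ^+ nat_of_bool _).
  have neg (x y : 'I_n) : x != y -> (x < y)%N = ~~ (y < x)%N.
    by move=> xy; rewrite -leqNgt ltn_neqAle xy.
  rewrite (neg a b ab) (neg b v bv) (neg a v av).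
  move: (b < a)%N (v < b)%N (v < a)%N (u < v)%N (u < a)%N (u < b)%N.
  by do 6!case.
apply: (sum_sign_reversing (@eperm_set_tpermK _ a b)) => E pm.
- exact: pm_eperm.
- case mE: (matchedb E); last by have [] := split E pm mE.
  have /exists_inP[e eE /eqP endsE] := mE.
  rewrite (matched E e) // oppr0 (matched _ (eperm t e)) ?imset_f //.
  rewrite ends_eperm endsE imsetU1 imset_set1 tpermL tpermR; exact: setUC.
- move=> EE; case mE: (matchedb E).
    by have /exists_inP[e eE /eqP endsE] := mE; exact: matched eE endsE.
  by have [_] := split E pm mE; rewrite EE eqxx.
Qed.

End Pfaffian.

(** * Pfaffians of low rank; independence *)

Local Open Scope ring_scope.

Lemma exists_left_kernel (F : fieldType) m d (G : 'M[F]_(m, d)) : (d < m)%N ->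
  exists2 c : 'rV_m, c != 0 & c *m G = 0.
Proof.
move=> dm; have /rowV0Pn[c /sub_kermxP cG c0] : kermx G != 0.
  rewrite -mxrank_eq0 mxrank_ker -lt0n subn_gt0.
  by apply: leq_ltn_trans (rank_leq_col _) dm.
by exists c.
Qed.

Section LowRank.

Variables (n : nat) (F : fieldType).
Implicit Types (U : {set 'I_n}) (M : 'I_n -> 'I_n -> F) (y : 'I_n -> F).

Definition set_row M v0 y (u v : 'I_n) : F :=
  if u == v0 then y v else if v == v0 then - y u else M u v.

Lemma set_row_antisym M v0 y : antisym M -> antisym (set_row M v0 y).
Proof.
move=> aM u v uv; rewrite /set_row.
have [uv0|uv0] := eqVneq u v0; have [vv0|vv0] := eqVneq v v0 => //.
- by move: uv; rewrite uv0 vv0 eqxx.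
- by rewrite opprK.
- exact: aM.
Qed.

(** Each matching has exactly one edge at [v0], so each term is linear in that row. *)
Lemma pf_set_row_sum (I : finType) M U v0 (c : I -> F) (y : I -> 'I_n -> F) :
    antisym M -> v0 \in U ->
  pf (set_row M v0 (fun v => \sum_i c i * y i v)) U =
    \sum_i c i * pf (set_row M v0 (y i)) U.
Proof.
move=> aM v0U; rewrite /pf; under [RHS]eq_bigr => i _ do rewrite mulr_sumr.
rewrite exchange_big; apply: eq_bigr => E pm.
have [e eE ve] := pm_edge pm v0U; have [w v0w endse] := endsP ve.
have termE y0 : pf_term (set_row M v0 y0) E = y0 w *
    ((-1) ^+ (w < v0)%N * ((-1) ^+ cr E *
      \prod_(f in E | f != e) M (val f).1 (val f).2)).
  rewrite /pf_term (bigD1 e) //=.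
  rewrite (antisym_edge (set_row_antisym v0 y0 aM) endse) {1}/set_row eqxx.
  rewrite [LHS](_ : _ = y0 w * ((-1) ^+ (w < v0)%N * ((-1) ^+ cr E *
     \prod_(f in E | f != e) set_row M v0 y0 (val f).1 (val f).2))); last first.
    by rewrite -[_ * y0 w * _]mulrA mulrCA [_ * (y0 w * _)]mulrCA [LHS]mulrCA.
  congr (_ * (_ * (_ * _))); apply: eq_bigr => f /andP[fE fe].
  have v0f : v0 \notin edge_ends f.
    by apply: contra fe => vf; apply/eqP; exact: pm_inj pm fE eE vf ve.
  move: v0f; rewrite !inE negb_or /set_row => /andP[/negbTE v1 /negbTE v2].
  by rewrite [_ == v0]eq_sym v1 [_ == v0]eq_sym v2.
by rewrite termE mulr_suml; apply: eq_bigr => i _; rewrite termE [RHS]mulrA.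
Qed.

(** In the row [v0], the combination of all rows with coefficients [c] is zero. By linearity its
    Pfaffian is a sum over [u] whose terms for [u != v0] vanish by alternation; [c v0 * pf M U]
    remains. *)
Lemma pf_dependent M U (c : 'I_n -> F) v0 : antisym M -> (forall v, M v v = 0) ->
    v0 \in U -> c v0 != 0 -> (forall u, u \notin U -> c u = 0) ->
    (forall v, \sum_u c u * M u v = 0) ->
  pf M U = 0.
Proof.
move=> aM M0 v0U cv0 cU cM.
have Mv0 : pf (set_row M v0 (M v0)) U = pf M U.
  apply: eq_bigr => E _; rewrite /pf_term; congr (_ * _).
  apply: eq_bigr => e _; rewrite /set_row.
  have [->|_] := eqVneq (val e).1 v0 => //; have [e2|//] := eqVneq (val e).2 v0.
  by rewrite e2 -aM // -e2 ends_neq.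
have zero : pf (set_row M v0 (fun=> 0)) U = 0.
  (* The zero row is a sum over the empty type, so linearity applies. *)
  apply: etrans (_ : \sum_(i : 'I_0) 0 * pf (set_row M v0 (fun=> 0)) U = 0).
    rewrite -(pf_set_row_sum (fun=> 0) (fun=> fun=> 0)) //.
    apply: eq_bigr => E _; rewrite /pf_term; congr (_ * _).
    by apply: eq_bigr => e _; rewrite /set_row !big_ord0.
  by rewrite big_ord0.
have : \sum_u c u * pf (set_row M v0 (M u)) U = 0.
  rewrite -pf_set_row_sum // -[RHS]zero; apply: eq_bigr => E _.
  rewrite /pf_term; congr (_ * _); apply: eq_bigr => e _.
  by rewrite /set_row !cM.
rewrite (bigD1 v0) //= Mv0 big1 ?addr0 => [/eqP|u uv0].
  by rewrite mulf_eq0 (negbTE cv0) => /eqP.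
have [uU|uU] := boolP (u \in U); last by rewrite cU ?mul0r.
rewrite (@pf_alternating _ _ _ _ v0 u) ?mulr0 // 1?eq_sym //.
- exact: set_row_antisym.
- by rewrite /set_row eqxx M0.
- by move=> v vv0 vu; rewrite /set_row eqxx (negbTE uv0) (negbTE vv0).
Qed.

(** The [k + k] vectors [A r], [B r], restricted to [U], have a common nonzero annihilator, which is
    a dependency between the rows of the matrix. *)
Lemma pf_low_rank k (A B : 'I_k -> 'I_n -> F) U : (k + k < #|U|)%N ->
  pf (fun u v => \sum_r (A r u * B r v - A r v * B r u)) U = 0.
Proof.
move=> kU; set M := fun _ _ => _.
pose G : 'M[F]_(#|U|, k + k) := row_mx
  (\matrix_(i, r) A r (enum_val i)) (\matrix_(i, r) B r (enum_val i)).
have [c c0 cG] := exists_left_kernel G kU.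
have [i0 ci0] : exists i, c 0 i != 0.
  apply/existsP; apply: contraNT c0; rewrite negb_exists => /forallP H.
  by apply/eqP/rowP => i; rewrite mxE; apply/eqP; have := H i; rewrite negbK.
set v0 := enum_val i0; have v0U : v0 \in U := enum_valP i0.
pose c' u := if u \in U then c 0 (enum_rank_in v0U u) else 0.
have sumE (f : 'I_n -> F) : \sum_u c' u * f u = \sum_i c 0 i * f (enum_val i).
  rewrite (bigID (mem U)) /= [X in _ + X]big1 ?addr0 => [|u uU]; last first.
    by rewrite /c' (negbTE uU) mul0r.
  rewrite (big_enum_val (fun u => c' u * f u)) /=.
  by apply: eq_bigr => i _; rewrite /c' enum_valP enum_valK_in.
have cA r : \sum_u c' u * A r u = 0.
  rewrite sumE; have := congr1 (fun H : 'rV_(k + k) => H 0 (lshift k r)) cG.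
  rewrite mul_mx_row row_mxEl [RHS]mxE => H; rewrite -[RHS]H mxE.
  by apply: eq_bigr => i _; rewrite mxE.
have cB r : \sum_u c' u * B r u = 0.
  rewrite sumE; have := congr1 (fun H : 'rV_(k + k) => H 0 (rshift k r)) cG.
  rewrite mul_mx_row row_mxEr [RHS]mxE => H; rewrite -[RHS]H mxE.
  by apply: eq_bigr => i _; rewrite mxE.
apply: (@pf_dependent _ _ c' v0) => //.
- move=> u v _; rewrite /M -sumrN; apply: eq_bigr => r _; ring.
- by move=> v; rewrite /M big1 // => r _; rewrite mulrC subrr.
- by rewrite /c' v0U enum_valK_in.
- by move=> u /negbTE uU; rewrite /c' uU.
- move=> v; rewrite /M; under eq_bigr => u _ do rewrite mulr_sumr.
  rewrite exchange_big big1 // => r _ /=.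
  transitivity ((\sum_u c' u * A r u) * B r v - A r v * (\sum_u c' u * B r u)).
    rewrite mulr_suml mulr_sumr -sumrB; apply: eq_bigr => u _; ring.
  by rewrite cA cB mul0r mulr0 subrr.
Qed.

Lemma meval_pfaffian U (M : 'I_n -> 'I_n -> F) :
  (pfaffian F U).@[fun i => let e := val (enum_val i) in M e.1 e.2] = pf M U.
Proof.
rewrite /pfaffian raddf_sum; apply: eq_bigr => E _ /=.
rewrite mevalM rmorphXn rmorphN1; congr (_ * _); rewrite rmorph_prod.
by apply: eq_bigr => e _; rewrite [LHS]mevalXU /= enum_rankK.
Qed.

End LowRank.

Section Independence.

Variable K : fieldType.

Lemma map_pfaffian (F : fieldType) (phi : {rmorphism K -> F}) n
    (U : {set 'I_n}) : map_mpoly phi (pfaffian K U) = pfaffian F U.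
Proof.
rewrite /pfaffian raddf_sum; apply: eq_bigr => E _ /=.
rewrite rmorphM rmorphXn rmorphN1; congr (_ * _); rewrite rmorph_prod.
by apply: eq_bigr => e _; rewrite [LHS]map_mpolyX.
Qed.

Lemma pfaffian_ideal_map (F : fieldType) (phi : {rmorphism K -> F}) n k
    (p : edge_poly K n) :
  pfaffian_ideal k p -> pfaffian_ideal k (map_mpoly phi p).
Proof.
move=> [c ->]; exists (fun U => map_mpoly phi (c U)).
by rewrite raddf_sum; apply: eq_bigr => U _ /=; rewrite rmorphM; congr (_ * _);
  exact: map_pfaffian.
Qed.

Lemma pfaffian_ideal_low_rank n k (p : edge_poly K n) (A B : 'I_k -> 'I_n -> K) :
    pfaffian_ideal k p ->
  p.@[fun i => let e := val (enum_val i) in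
       \sum_r (A r e.1 * B r e.2 - A r e.2 * B r e.1)] = 0.
Proof.
move=> [c ->]; rewrite raddf_sum big1 //= => U /eqP cU.
rewrite mevalM (meval_pfaffian U
  (fun u v => \sum_r (A r u * B r v - A r v * B r u))) pf_low_rank ?mulr0 //.
by rewrite cU mul2n -addnn addn2 leqW.
Qed.

End Independence.

Lemma horner_binomial (F : fieldType) (a b t : F) m :
  (a%:P - 'X^m * b%:P).[t] = a - t ^+ m * b.
Proof. by rewrite hornerD hornerN hornerM hornerXn !hornerC. Qed.

(* The weight [rgt - lft] of an edge singles out the summands [A r e.1 * B r e.2]
   in the entries of an antisymmetric matrix of rank 2k. *)
Lemma crossing_free_independent_infinite (F : fieldType) n k (S : {set edge n}) :
    (forall s : seq F, exists x, x \notin s) -> (k + k <= n)%N ->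
  crossing_free k.+1 S -> matroid_independent F k S.
Proof.
move=> F_inf kn free q qI qS; apply/eqP; apply: contraT => q0.
pose w (i : 'I_#|{: edge n}|) := (rgt (enum_val i) - lft (enum_val i))%N.
have Q0 : initial_form w q != 0 by exact: initial_form_neq0.
have QS : only_involves S (initial_form w q).
  by move=> m e /msupp_initial_form; exact: qS.
have [A [B qx]] := rank_k_dense F_inf kn free QS Q0.
pose x (i : 'I_#|{: edge n}|) : F :=
  \sum_r A r (val (enum_val i)).1 * B r (val (enum_val i)).2.
pose x' (i : 'I_#|{: edge n}|) : F :=
  \sum_r A r (val (enum_val i)).2 * B r (val (enum_val i)).1.
(* With [A r v] scaled by [t ^+ v] and [B r v] by [t ^- v], the entry of the antisymmetric matrix is
   [(g i).[t] / t ^+ w i]. *)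
pose g i : {poly F} := (x i)%:P - 'X^(w i + w i) * (x' i)%:P.
have w_gt0 i : (0 < w i)%N by rewrite subn_gt0 lft_lt_rgt.
have gx i : (g i).[0] = x i.
  rewrite /g horner_binomial expr0n.
  by rewrite addn_eq0 eqn0Ngt w_gt0 mul0r subr0.
have [t t0] := eval_near_initial_form F_inf gx qx.
case/eqP; have := pfaffian_ideal_low_rank
  (fun r v => t ^+ v * A r v) (fun r v => t ^- v * B r v) qI.
move=> <-; apply: meval_eq => i /=.
rewrite /g horner_binomial /x /x' /w /rgt /lft.
move: (enum_val i) => e.
have le : ((val e).1 <= (val e).2)%N := ltnW (lft_lt_rgt e).
rewrite mulrBl sumrB mulr_sumr !mulr_suml.
have tE : t ^+ (val e).2 = t ^+ ((val e).2 - (val e).1) * t ^+ (val e).1.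
  by rewrite -exprD subnK.
have tn0 m : t ^+ m != 0 by rewrite expf_neq0.
congr (_ - _); apply: eq_bigr => r _; rewrite tE ?exprD;
  move: (tn0 ((val e).2 - (val e).1)%N) (tn0 (val e).1);
  move: (t ^+ _) (t ^+ _) => a b a0 b0; field; by rewrite a0 b0.
Qed.

(** * Base change to an infinite field *)

Section Transfer.

Variable K : fieldType.

Lemma fracpoly_infinite (s : seq {fraction {poly K}}) : exists x, x \notin s.
Proof.
pose h (i : nat) := FracField.tofrac ('X^i : {poly K}).
have h_inj : injective h.
  move=> i j /eqP; rewrite tofrac_eq => /eqP/(congr1 (size \o val)) /=.
  by rewrite !size_polyXn => -[].
have /allPn[x _ xs] : ~~ all (mem s) (map h (iota 0 (size s).+1)).
  apply/negP => /allP sub.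
  have := uniq_leq_size _ sub; rewrite (map_inj_uniq h_inj) iota_uniq.
  by rewrite size_map size_iota ltnn => /(_ isT).
by exists x.
Qed.

(** The field of rational functions over [K] is infinite, and base change preserves the ideal and
    the support of [p]. *)
Lemma crossing_free_independent n k (S : {set edge n}) : (k + k <= n)%N ->
  crossing_free k.+1 S -> matroid_independent K k S.
Proof.
move=> kn free p pI pS.
pose F : fieldType := {fraction {poly K}}.
pose phi : {rmorphism K -> F} := (@FracField.tofrac {poly K}) \o polyC.
have qm m : (map_mpoly phi p)@_m = phi p@_m by rewrite mcoeff_map_mpoly.
have q0 : map_mpoly phi p = 0.
  apply: (crossing_free_independent_infinite (@fracpoly_infinite) kn free).
    exact: pfaffian_ideal_map.
  by move=> m e; rewrite mcoeff_msupp qm fmorph_eq0 -mcoeff_msupp; exact: pS.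
by apply/mpolyP => m; apply/eqP; rewrite mcoeff0 -(fmorph_eq0 phi) -qm q0 mcoeff0.
Qed.

End Transfer.

(** * Crossing matchings have the largest spread *)

Local Open Scope nat_scope.

Section CrossingMatching.

Variable n : nat.
Implicit Types (e f g : edge n) (E C : {set edge n}) (U : {set 'I_n}).

Local Notation ends := (@edge_ends n).

(** A strictly concave function of the length, symmetric under replacing the length by [n] minus it.
    Concavity favours the crossing pair over the nested one and, with the symmetry, over the
    disjoint one. *)
Definition spread e := (rgt e - lft e) * (n - (rgt e - lft e)).

Definition total_spread E := \sum_(e in E) spread e.

Lemma ends_lt e (x y : 'I_n) : ends e = [set x; y] -> x < y ->
  lft e = x /\ rgt e = y.
Proof.
move=> eE xy; have := lft_lt_rgt e; rewrite /lft /rgt.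
by have [[-> ->]|[-> ->]] := ends2P eE => //; lia.
Qed.

Lemma spread_swap U E e f (x y : 'I_n) : perfect_matching U E ->
    e \in E -> f \in E -> e != f -> x \in ends e -> y \in ends f ->
    spread e + spread f <
      spread (eperm (tperm x y) e) + spread (eperm (tperm x y) f) ->
  perfect_matching U (eperm (tperm x y) @: E) /\
  total_spread E < total_spread (eperm (tperm x y) @: E).
Proof.
move=> pm eE fE ef xe yf lt_ef; split.
  by apply: (pm_eperm _ pm); apply: tperm_setE;
    [exact: pm_ends pm eE xe|exact: pm_ends pm fE yf].
rewrite /total_spread big_imset /=; last first.
  by move=> g g' _ _; apply: inv_inj; exact: epermK_tperm.
rewrite (bigD1 e) //= (bigD1 f) /=; last by rewrite fE eq_sym.
rewrite [X in _ < X](bigD1 e) //= [X in _ < _ + X](bigD1 f) /=; last first.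
  by rewrite fE eq_sym.
rewrite !addnA -addSn leq_add //; apply: eq_leq; apply: eq_bigr => g.
move=> /andP[/andP[gE ge] gf]; rewrite eperm_tperm_id //.
  by apply: contra ge => xg; apply/eqP; exact: pm_inj pm gE eE xg xe.
by apply: contra gf => yg; apply/eqP; exact: pm_inj pm gE fE yg yf.
Qed.

(* Replacing two noncrossing edges by the crossing pair on the same four
   vertices increases the total spread. *)
Lemma uncrossed_improve U E : perfect_matching U E -> ~ pairwise_crossing E ->
  exists2 E', perfect_matching U E' & total_spread E < total_spread E'.
Proof.
move=> pm ncr.
have [e [f [eE fE lt_ef nef]]] :
    exists e f, [/\ e \in E, f \in E, lft e < lft f & ~~ cross e f].
  have /exists_inP[e eE /exists_inP[f fE]] :
      [exists e in E, exists f in E, (e != f) && ~~ cross e f].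
    apply: contraPT ncr => /exists_inPn H; apply=> e f eE fE ef.
    by have /exists_inPn/(_ f fE) := H e eE; rewrite ef negbK.
  move=> /andP[ef nef]; have [lt|lt|eq] := ltngtP (lft e) (lft f).
  - by exists e, f.
  - by exists f, e; rewrite crossC.
  - case/eqP: ef; apply: (pm_inj pm eE fE (v := (val e).1)); first exact: set21.
    by rewrite (_ : (val e).1 = (val f).1) ?set21 //; exact: val_inj.
have ef : e != f by apply: contraTneq lt_ef => ->; rewrite ltnn.
have disj x : x \in ends e -> x \notin ends f.
  by move=> xe; apply: contra ef => xf; apply/eqP; exact: pm_inj pm eE fE xe xf.
have := lft_lt_rgt e; have := lft_lt_rgt f; have := rgt_lt e; have := rgt_lt f.
have : rgt e != lft f.
  apply: contraTneq (disj _ (set22 _ _)) => H.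
  by rewrite negbK (_ : (val e).2 = (val f).1) ?set21 //; exact: val_inj.
have : rgt e != rgt f.
  apply: contraTneq (disj _ (set22 _ _)) => H.
  by rewrite negbK (_ : (val e).2 = (val f).2) ?set22 //; exact: val_inj.
have eE' : ends e = [set (val e).2; (val e).1] by rewrite /edge_ends setUC.
have := nef; have := lt_ef; rewrite crossE.
set a := lft e; set b := rgt e; set c := lft f; set d := rgt f.
move=> ac ncr' bd bc dn bn cd ab.
have [b_c|c_b] := ltnP b c.
  (* Disjoint edges: the right end of [e] is exchanged with the left end of [f]. *)
  have [e1 e2] : lft (eperm (tperm (val e).2 (val f).1) e) = a /\
      rgt (eperm (tperm (val e).2 (val f).1) e) = c.
    apply: ends_lt => //; rewrite setUC; apply: (ends_eperm_tperml _ eE').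
    by rewrite -val_eqE /= -/(lft f) -/(lft e) -/a -/c gtn_eqF.
  have [f1 f2] : lft (eperm (tperm (val e).2 (val f).1) f) = b /\
      rgt (eperm (tperm (val e).2 (val f).1) f) = d.
    apply: ends_lt; last by rewrite -/(rgt e) -/(rgt f) -/b -/d; lia.
    apply: ends_eperm_tpermr => //.
  have [|pm' lt'] := spread_swap (x := (val e).2) (y := (val f).1)
      pm eE fE ef (set22 _ _) (set21 _ _).
    rewrite /spread e1 e2 f1 f2 -/a -/b -/c -/d.
    by move: ac bd bc dn bn cd ab b_c; clear; nia.
  by exists (eperm (tperm (val e).2 (val f).1) @: E).
have d_b : d < b by move: ncr'; lia.
(* Nested edges: the two right ends are exchanged. *)
have [e1 e2] : lft (eperm (tperm (val e).2 (val f).2) e) = a /\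
    rgt (eperm (tperm (val e).2 (val f).2) e) = d.
  apply: ends_lt; last by rewrite -/(lft e) -/(rgt f) -/a -/d; lia.
  rewrite setUC; apply: (ends_eperm_tperml _ eE').
  by rewrite -val_eqE /= -/(rgt f) -/(lft e) -/a -/d; lia.
have [f1 f2] : lft (eperm (tperm (val e).2 (val f).2) f) = c /\
    rgt (eperm (tperm (val e).2 (val f).2) f) = b.
  apply: ends_lt; last by rewrite -/(lft f) -/(rgt e) -/b -/c; lia.
  rewrite setUC; apply: ends_eperm_tpermr => //.
  by rewrite /edge_ends setUC.
have [|pm' lt'] := spread_swap (x := (val e).2) (y := (val f).2)
    pm eE fE ef (set22 _ _) (set22 _ _).
  rewrite /spread e1 e2 f1 f2 -/a -/b -/c -/d.
  by move: ac bd bc dn bn cd ab d_b; clear; nia.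
by exists (eperm (tperm (val e).2 (val f).2) @: E).
Qed.

Definition pos U (v : 'I_n) := \sum_(u in U) (u < v).

Lemma pos_inj U : {in U &, injective (pos U)}.
Proof.
have lt_pos (u v : 'I_n) : u \in U -> u < v -> pos U u < pos U v.
  move=> uU uv; rewrite /pos (bigD1 u) // [X in _ < X](bigD1 u) //= ltnn uv.
  rewrite add0n add1n ltnS leq_sum // => w _.
  by case: (ltnP w u) => // /ltn_trans/(_ uv) ->.
move=> u v uU vU; case: (ltngtP u v) => [uv|vu|uv _]; last exact: val_inj.
  by have := lt_pos u v uU uv; lia.
by have := lt_pos v u vU vu; lia.
Qed.

(** All left ends of a crossing precede all right ends, and both come in the same order; so [U]
    determines the crossing matching. *)
Lemma pos_crossing U C e : perfect_matching U C -> pairwise_crossing C ->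
    e \in C ->
  pos U (val e).1 < #|C| /\ pos U (val e).2 = #|C| + pos U (val e).1.
Proof.
move=> pm crC eC.
have H f : f \in C -> f = e \/ cross f e.
  by move=> fC; have [|fe] := eqVneq f e; [left|right; exact: crC].
have lE : pos U (val e).1 = \sum_(f in C) (lft f < lft e).
  rewrite /pos (pm_big addn (fun u : 'I_n => (u < (val e).1) : nat) pm) /=.
  apply: eq_bigr => f /H; rewrite crossE /lft /rgt.
  have := lft_lt_rgt e; rewrite /lft /rgt /= => e12 [->|/orP[/and3P[]|/and3P[]]];
    move=> *; lia.
rewrite lE; split.
  rewrite -sum1_card (bigD1 e) // [X in _ < X](bigD1 e) //= ltnn add0n add1n ltnS.
  by apply: leq_sum => f _; case: (_ < _).
rewrite -sum1_card -big_split /pos.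
rewrite (pm_big addn (fun u : 'I_n => (u < (val e).2) : nat) pm) /=.
apply: eq_bigr => f /H; rewrite crossE /lft /rgt.
by have := lft_lt_rgt e; rewrite /lft /rgt /= => e12 [->|/orP[/and3P[]|/and3P[]]];
    move=> *; lia.
Qed.

Lemma card_matching U E : perfect_matching U E -> #|U| = 2 * #|E|.
Proof.
move=> pm; rewrite -sum1_card (pm_big addn (fun=> 1) pm) sum_nat_const mulnC.
by rewrite mulnC.
Qed.

Lemma crossing_matching_uniq U C C' :
    perfect_matching U C -> pairwise_crossing C ->
    perfect_matching U C' -> pairwise_crossing C' ->
  C = C'.
Proof.
move=> pm cr pm' cr'.
have cC : #|C| = #|C'|.
  by have := card_matching pm; have := card_matching pm'; lia.
apply/eqP; rewrite eqEcard cC leqnn andbT; apply/subsetP => e eC.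
have xU : (val e).1 \in U by apply: (pm_ends pm eC); exact: set21.
have yU : (val e).2 \in U by apply: (pm_ends pm eC); exact: set22.
have [e' e'C] := pm_edge pm' xU.
have [lt pE] := pos_crossing pm cr eC; have [lt' pE'] := pos_crossing pm' cr' e'C.
rewrite !inE => /orP[]/eqP xe'; last first.
  by move: pE' lt; rewrite -xe' cC => ->; rewrite ltnNge leq_addr.
suff -> : e = e' by [].
have y'U : (val e').2 \in U by apply: (pm_ends pm' e'C); exact: set22.
have yy' : (val e).2 = (val e').2.
  by apply: (@pos_inj U) => //; rewrite pE pE' cC xe'.
by apply: edge_eq; rewrite /lft /rgt ?xe' ?yy'.
Qed.

(** A matching of largest spread is crossing by [uncrossed_improve], hence equal to [C]; a matching
    that ties with [C] is itself of largest spread. *)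
Lemma crossing_matching_max U C E : perfect_matching U C -> pairwise_crossing C ->
  perfect_matching U E -> E != C -> total_spread E < total_spread C.
Proof.
move=> pmC crC pmE neC.
have crossing_of_max E0 : perfect_matching U E0 ->
    (forall E1, perfect_matching U E1 -> total_spread E1 <= total_spread E0) ->
    E0 = C.
  move=> pm0 max0; apply: (crossing_matching_uniq pm0 _ pmC crC).
  have [//|ncr] : pairwise_crossing E0 \/ ~ pairwise_crossing E0.
    have [/forall_inP H|/forall_inPn[e eE /forall_inPn[f fE H]]] :=
        boolP [forall e in E0, forall f in E0, (e != f) ==> cross e f].
      by left=> e f eE fE ef; have /forall_inP/(_ f fE)/implyP := H e eE; apply.
    by right=> cr0; move: H; rewrite negb_imply => /andP[ef /negP]; apply; exact: cr0.
  have [E1 pm1] := uncrossed_improve pm0 ncr.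
  by rewrite ltnNge max0.
have [E0 pm0 max0] := arg_maxnP total_spread pmC.
have E0C := crossing_of_max E0 pm0 max0.
have le_max E1 : perfect_matching U E1 -> total_spread E1 <= total_spread C.
  by rewrite -E0C => /max0.
rewrite ltn_neqAle le_max // andbT; apply: contra neC => /eqP tE.
by apply/eqP; apply: crossing_of_max => // E1 pm1; rewrite tE; exact: le_max.
Qed.

Lemma crossing_perfect_matching C : pairwise_crossing C ->
  perfect_matching (\bigcup_(e in C) ends e) C.
Proof.
move=> crC; apply/perfect_matchingP; split.
- by move=> e eC; apply: (bigcup_max e).
- by move=> v /bigcupP[e eC ve]; exists e.
- move=> e f v eC fC; rewrite !inE => ve vf; apply/eqP; apply: contraT => ef.
  have := crC e f eC fC ef; rewrite crossE /lft /rgt.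
  have := lft_lt_rgt e; have := lft_lt_rgt f; rewrite /lft /rgt.
  by case/orP: ve => /eqP ve; case/orP: vf => /eqP vf;
    rewrite -?ve -?vf; lia.
Qed.

End CrossingMatching.

(** * Standard monomials and the rank *)

Local Open Scope ring_scope.

Section StandardMonomials.

Variables (K : fieldType) (n k : nat).
Implicit Types (p q : edge_poly K n) (U : {set 'I_n}).

Local Notation N := #|{: edge n}|.
Implicit Types (m : 'X_{1..N}) (E C : {set edge n}).

Lemma pfaffian_idealD p q : pfaffian_ideal k p -> pfaffian_ideal k q ->
  pfaffian_ideal k (p + q).
Proof.
move=> [c ->] [d ->]; exists (fun U => c U + d U).
by rewrite -big_split; apply: eq_bigr => U _; rewrite mulrDl.
Qed.

Lemma pfaffian_idealM p q : pfaffian_ideal k q -> pfaffian_ideal k (p * q).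
Proof.
move=> [c ->]; exists (fun U => p * c U).
by rewrite mulr_sumr; apply: eq_bigr => U _; rewrite mulrA.
Qed.

Lemma pfaffian_ideal0 : pfaffian_ideal k (0 : edge_poly K n).
Proof. by exists (fun=> 0); rewrite big1 // => U _; rewrite mul0r. Qed.

Lemma pfaffian_idealZ (a : K) p : pfaffian_ideal k p -> pfaffian_ideal k (a *: p).
Proof. by rewrite -mul_mpolyC; exact: pfaffian_idealM. Qed.

Lemma pfaffian_ideal_sum (I : finType) (P : pred I) (F : I -> edge_poly K n) :
  (forall i, P i -> pfaffian_ideal k (F i)) ->
  pfaffian_ideal k (\sum_(i | P i) F i).
Proof.
by move=> H; apply: big_ind => //;
  [exact: pfaffian_ideal0|move=> p q; exact: pfaffian_idealD].
Qed.

Lemma pfaffian_in_ideal U : #|U| = (2 * k + 2)%N ->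
  pfaffian_ideal k (pfaffian K U).
Proof.
move=> cU; exists (fun V => (V == U)%:R).
rewrite (bigD1 U) ?cU //= eqxx mul1r big1 ?addr0 // => V /andP[_ /negbTE ->].
by rewrite mul0r.
Qed.

Definition mono E : 'X_{1..N} := [multinom (enum_val i \in E : nat) | i < N].

Lemma mpolyX_mono E : 'X_[mono E] = \prod_(e in E) 'X_(enum_rank e) :> edge_poly K n.
Proof.
rewrite mpolyXE_id (reindex enum_rank) /=; last first.
  by apply: onW_bij; exact: enum_rank_bij.
rewrite [RHS]big_mkcond; apply: eq_bigr => e _; rewrite mnmE enum_rankK.
by case: (e \in E); rewrite ?expr1 ?expr0.
Qed.

Definition msupport m : {set edge n} := [set e | m (enum_rank e) != 0%N].

Definition standard m := crossing_free k.+1 (msupport m).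

Definition mspread m := mwt (fun i => spread (enum_val i)) m.

Lemma mspreadD m1 m2 : mspread (m1 + m2)%MM = (mspread m1 + mspread m2)%N.
Proof.
by rewrite /mspread /mwt -big_split; apply: eq_bigr => i _; rewrite mnmDE mulnDl.
Qed.

Lemma mspread_mono E : mspread (mono E) = total_spread E.
Proof.
rewrite /mspread /mwt (reindex enum_rank) /=; last first.
  by apply: onW_bij; exact: enum_rank_bij.
rewrite /total_spread [RHS]big_mkcond; apply: eq_bigr => e _.
by rewrite mnmE enum_rankK; case: (e \in E); rewrite ?mul1n.
Qed.

Lemma mdeg_mono E : mdeg (mono E) = #|E|.
Proof.
rewrite mdegE (reindex enum_rank) /=; last first.
  by apply: onW_bij; exact: enum_rank_bij.
rewrite -[RHS]sum1_card [RHS]big_mkcond; apply: eq_bigr => e _.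
by rewrite mnmE enum_rankK; case: (e \in E).
Qed.

(* The crossing monomials are the leading terms of the Pfaffians for the weight
   [spread], so that standard monomials span modulo the ideal. *)
Lemma standard_reduction m : exists q : edge_poly K n,
  pfaffian_ideal k ('X_[m] - q) /\
  (forall m', ~~ (standard m' && (mdeg m' == mdeg m)) -> q@_m' = 0).
Proof.
have [b] := ubnP (mspread m); elim: b m => // b IH m le_b.
have [std|nstd] := boolP (standard m).
  exists 'X_[m]; rewrite subrr; split; first exact: pfaffian_ideal0.
  move=> m'; by rewrite mcoeffX; case: (m =P m') => // <-; rewrite std eqxx.
move: nstd; rewrite negbK => /existsP[C /andP[Cm /is_crossingP[cC crC]]].
set U := \bigcup_(e in C) edge_ends e.
have pmC : perfect_matching U C by exact: crossing_perfect_matching.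
have cU : #|U| = (2 * k + 2)%N by rewrite (card_matching pmC) cC; lia.
pose m0 := (m - mono C)%MM.
have mE : m = (m0 + mono C)%MM.
  rewrite /m0 submK //; apply/mnm_lepP => i; rewrite mnmE.
  case: (boolP (enum_val i \in C)) => // /(subsetP Cm).
  by rewrite inE enum_valK lt0n.
pose P E := perfect_matching U E && (E != C).
have /fin_all_exists[q qP] E : exists q : edge_poly K n, P E ->
    pfaffian_ideal k ('X_[m0 + mono E] - q) /\
    (forall m', ~~ (standard m' && (mdeg m' == mdeg m)) -> q@_m' = 0).
  case PE: (P E); last by exists 0.
  have /andP[pmE EC] := PE.
  have degE : mdeg (m0 + mono E)%MM = mdeg m.
    rewrite mE !mdegD !mdeg_mono.
    by have := card_matching pmC; have := card_matching pmE; lia.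
  have [|q] := IH (m0 + mono E)%MM.
    rewrite ltnS in le_b; apply: leq_trans le_b.
    rewrite [in X in (_ < X)%N]mE !mspreadD !mspread_mono ltn_add2l.
    exact: (crossing_matching_max pmC crC pmE EC).
  by rewrite degE; exists q.
(* The Pfaffian of [U] times ['X_[m0]] is solved for its leading term ['X_[m]]; the other terms have
   smaller spread and are replaced by their reductions. *)
exists (- \sum_(E | P E) ((-1) ^+ (cr C + cr E)) *: q E); split; last first.
  move=> m' nm'; rewrite mcoeffN raddf_sum big1 ?oppr0 //= => E PE.
  by rewrite mcoeffZ; have [_ ->] := qP E PE; rewrite ?mulr0.
have -> : 'X_[m] - - (\sum_(E | P E) (-1) ^+ (cr C + cr E) *: q E) =
   (-1) ^+ cr C *: ('X_[m0] * pfaffian K U) + \sum_(E | P E)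
     (- (-1) ^+ (cr C + cr E)) *: ('X_[m0 + mono E] - q E).
  have -> : pfaffian K U = (-1) ^+ cr C *: 'X_[mono C]
      + \sum_(E | P E) (-1) ^+ cr E *: 'X_[mono E].
    have sgn (j : nat) (p : edge_poly K n) : (-1) ^+ j * p = (-1) ^+ j *: p.
      by rewrite -[RHS]mul_mpolyC rmorphXn /= rmorphN1.
    rewrite /pfaffian (bigD1 C) //= sgn mpolyX_mono; congr (_ + _).
    by apply: eq_bigr => E _; rewrite sgn mpolyX_mono.
  rewrite mulrDr -scalerAr -mpolyXD -mE scalerDr scalerA -expr2 sqrr_sign scale1r.
  rewrite opprK mulr_sumr scaler_sumr -addrA -big_split; congr (_ + _).
  apply: eq_bigr => E _ /=; rewrite -scalerAr -mpolyXD scalerA -exprD.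
  by rewrite scalerBr !scaleNr opprK addrA subrr add0r.
apply: pfaffian_idealD.
  by apply: pfaffian_idealZ; apply: pfaffian_idealM; exact: pfaffian_in_ideal.
apply: pfaffian_ideal_sum => E PE; apply: pfaffian_idealZ.
by have [] := qP E PE.
Qed.

Lemma card_pffun_support (S : {set edge n}) b :
  #|pffun_on (ord0 : 'I_b.+1) [pred i : 'I_N | enum_val i \in S] predT| =
  (b.+1 ^ #|S|)%N.
Proof.
rewrite card_pffun_on card_ord; congr (_ ^ _)%N.
rewrite -(card_image enum_rank_inj S); apply: eq_card => i; rewrite inE.
by apply/idP/imageP => [iS|[e eS ->]]; [exists (enum_val i); rewrite ?enum_valK|
  rewrite enum_rankK].
Qed.

Definition bounded_mono b (f : {ffun 'I_N -> 'I_b}) : 'X_{1..N} :=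
  [multinom (f i : nat) | i < N].

(** There are at most [2 ^ N] supports, and a crossing-free one has at most [d] elements, so it
    carries at most [D.+1 ^ d] monomials. *)
Lemma card_standard d D :
    (forall S : {set edge n}, crossing_free k.+1 S -> #|S| <= d)%N ->
  (#|[set g : {ffun 'I_N -> 'I_D.+1} | standard (bounded_mono g)]|
     <= 2 ^ N * D.+1 ^ d)%N.
Proof.
move=> le_d; rewrite -sum1_card.
rewrite (partition_big (fun g => msupport (bounded_mono g)) predT) //=.
have -> : (2 ^ N * D.+1 ^ d = \sum_(S : {set edge n}) D.+1 ^ d)%N.
  by rewrite sum_nat_const -[in RHS]cardsT -powersetT card_powerset cardsT.
apply: leq_sum => S _; have [free|nfree] := boolP (crossing_free k.+1 S); last first.
  rewrite big1 // => g; rewrite inE /standard => /andP[std /eqP gS].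
  by rewrite gS (negbTE nfree) in std.
rewrite sum1dep_card; apply: leq_trans (_ : D.+1 ^ #|S| <= _)%N; last first.
  by apply: leq_pexp2l => //; exact: le_d.
rewrite -card_pffun_support; apply: subset_leq_card; apply/subsetP => g.
rewrite !inE => /andP[_ /eqP gS]; apply/pffun_onP; split => //.
apply/supportP => i; rewrite inE -gS inE mnmE enum_valK negbK => /eqP g0.
exact: val_inj.
Qed.

Lemma mdeg_bounded b (S : {set edge n}) (f : {ffun 'I_N -> 'I_b.+1}) :
    f \in pffun_on ord0 [pred i | enum_val i \in S] predT ->
  (mdeg (bounded_mono f) <= #|S| * b)%N.
Proof.
move=> /pffun_onP[/supportP f0 _]; rewrite mdegE (reindex enum_rank) /=; last first.
  by apply: onW_bij; exact: enum_rank_bij.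
rewrite -sum_nat_const [X in (_ <= X)%N]big_mkcond; apply: leq_sum => e _.
rewrite mnmE; case: ifP => eS; first by rewrite -ltnS.
by rewrite f0 // inE enum_rankK eS.
Qed.

Lemma bounded_mono_inj b : injective (@bounded_mono b).
Proof.
move=> f g /mnmP fg; apply/ffunP => i; apply/val_inj.
by have := fg i; rewrite !mnmE.
Qed.

(** If [S] had more than [d] elements, its monomials with exponents at most [b] would outnumber the
    standard monomials available for their reductions; a linear dependency among the reductions
    gives a nonzero polynomial of the ideal in the variables of [S]. *)
Lemma independent_card d (S : {set edge n}) :
    (forall S : {set edge n}, crossing_free k.+1 S -> #|S| <= d)%N ->
  matroid_independent K k S -> (#|S| <= d)%N.
Proof.
move=> le_d indep; rewrite leqNgt; apply/negP => d_lt.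
(* [b] is chosen so that [2 ^ N * D.+1 ^ d <= b * b.+1 ^ d < b.+1 ^ d.+1 <= b.+1 ^ s]; [D] bounds
   the degrees of the monomials in [A1]. *)
pose s := #|S|; pose b := (2 ^ N * s.+1 ^ d)%N; pose D := (s * b)%N.
pose A1 := [set f : {ffun 'I_N -> 'I_b.+1} |
              f \in pffun_on ord0 [pred i | enum_val i \in S] predT].
pose A2 := [set g : {ffun 'I_N -> 'I_D.+1} | standard (bounded_mono g)].
have cA : (#|A2| < #|A1|)%N.
  have -> : #|A1| = (b.+1 ^ s)%N by rewrite cardsE; exact: card_pffun_support.
  apply: leq_ltn_trans (card_standard D le_d) _.
  apply: leq_ltn_trans (_ : b * b.+1 ^ d < _)%N.
    rewrite {1}/b -mulnA leq_mul2l -expnMn; apply/orP; right.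
    have le_D : (D.+1 <= s.+1 * b.+1)%N by rewrite /D; lia.
    by case: (d) => [//|d']; rewrite leq_exp2r.
  apply: leq_trans (_ : b.+1 ^ d.+1 <= _)%N; last by apply: leq_pexp2l.
  by rewrite expnS ltn_pmul2r ?expn_gt0.
have /fin_all_exists[q qP] (f : {ffun 'I_N -> 'I_b.+1}) :=
  standard_reduction (bounded_mono f).
pose G : 'M[K]_(#|A1|, #|A2|) :=
  \matrix_(i, j) (q (enum_val i))@_(bounded_mono (enum_val j)).
have [c c0 cG] := exists_left_kernel G cA.
(* Reductions keep the degree, so their monomials have exponents at most [D] and are all counted in
   [A2]. *)
have zero : \sum_i c 0 i *: q (enum_val i) = 0.
  apply/mpolyP => m; rewrite raddf_sum mcoeff0 /=.
  under eq_bigr => i _ do rewrite mcoeffZ.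
  have deg_le (i : 'I_#|A1|) : (mdeg (bounded_mono (enum_val i)) <= D)%N.
    by have := enum_valP i; rewrite inE => /mdeg_bounded.
  have [/andP[std degm]|bad] := boolP (standard m && (mdeg m <= D)%N); last first.
    apply: big1 => i _; have [_ ->] := qP (enum_val i); rewrite ?mulr0 //.
    by apply: contra bad => /andP[-> /eqP ->] /=.
  have m_lt i : (m i < D.+1)%N.
    rewrite ltnS; apply: leq_trans degm; rewrite mdegE (bigD1 i) //=.
    exact: leq_addr.
  pose g : {ffun 'I_N -> 'I_D.+1} := [ffun i => Ordinal (m_lt i)].
  have gm : bounded_mono g = m by apply/mnmP => i; rewrite mnmE ffunE.
  have gA : g \in A2 by rewrite inE gm.
  have := congr1 (fun M : 'rV_#|A2| => M 0 (enum_rank_in gA g)) cG.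
  rewrite mxE [RHS]mxE => H; rewrite -[RHS]H; apply: eq_bigr => i _.
  by rewrite mxE enum_rankK_in // gm.
pose p := \sum_i c 0 i *: 'X_[bounded_mono (enum_val i)] : edge_poly K n.
have p_coeff i : p@_(bounded_mono (enum_val i)) = c 0 i.
  rewrite /p raddf_sum (bigD1 i) //= mcoeffZ mcoeffX eqxx mulr1 big1 ?addr0 //.
  move=> j ji; rewrite mcoeffZ mcoeffX (inj_eq (@bounded_mono_inj _)).
  by rewrite (inj_eq enum_val_inj) (negbTE ji) mulr0.
have pI : pfaffian_ideal k p.
  rewrite -[p]subr0 -zero /p -sumrB; apply: pfaffian_ideal_sum => i _.
  by rewrite -scalerBr; apply: pfaffian_idealZ; have [] := qP (enum_val i).
have pS : only_involves S p.
  move=> m e mp me; apply: contraNT me => eS.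
  have [i /eqP mi] : exists i : 'I_#|A1|, bounded_mono (enum_val i) == m.
    apply/existsP; apply: contraLR mp; rewrite negb_exists => /forallP H.
    rewrite mcoeff_msupp negbK /p raddf_sum big1 //= => i _.
    by rewrite mcoeffZ mcoeffX (negbTE (H i)) mulr0.
  have := enum_valP i; rewrite inE => /pffun_onP[/supportP f0 _].
  by rewrite -mi mnmE f0 // inE enum_rankK.
have p0 := indep p pI pS; case/eqP: c0; apply/rowP => i.
by rewrite mxE -p_coeff p0 mcoeff0.
Qed.

End StandardMonomials.

(** * Independence, and bases by comparing cardinalities *)

Theorem corollary2p15 (K : fieldType) (n k : nat) (hk : (1 <= k)%N)
    (hn : (2 * k + 2 <= n)%N) :
  (forall S : {set edge n}, crossing_free k.+1 S -> matroid_independent K k S) /\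
  (forall T : {set edge n}, triangulation k T -> matroid_basis K k T).
Proof.
have kn : (k + k <= n)%N by lia.
have free_indep := fun S => @crossing_free_independent K n k S kn.
split=> // T /maxsetP[freeT maxT]; split; first exact: free_indep.
move=> S indepS TS; apply/eqP; rewrite eq_sym eqEcard TS /=.
have lt0n : (0 < n)%N by lia.
have lt1n : (1 < n)%N by lia.
pose e0 : edge n := exist _ (Ordinal lt0n, Ordinal lt1n) isT.
have extend S' : crossing_free k.+1 S' -> exists D : {set edge n},
    [/\ S' \subset ~: D, crossing_free k.+1 (~: D)
      & #|D| = #|inversions (rev_mid kn)|].
  move=> /(crossing_free_extend e0 kn)[D [DS _ freeD cD]]; exists D; split=> //.
  by rewrite -disjoints_subset disjoint_sym.
have cardC (D : {set edge n}) : #|D| = #|inversions (rev_mid kn)| ->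
    #|~: D| = (#|{: edge n}| - #|inversions (rev_mid kn)|)%N.
  by move=> <-; rewrite -(cardsC D) addKn.
(* As [T] lies in [S], it is enough that [S] is not larger than [T], hence that no crossing-free set
   is. *)
apply: independent_card indepS => S' freeS'.
have [D [S'D _ cD]] := extend _ freeS'.
have [D' [TD' freeD' cD']] := extend _ freeT.
(* Maximality makes [T] the complement of [D'], which has the size of the complement of [D], and the
   latter contains [S']. *)
rewrite -(maxT _ freeD' TD') (cardC _ cD') -(cardC _ cD); exact: subset_leq_card.
Qed.
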